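(* Let $d\ge2$ be an integer and let $A$ be a multiplicative subgroup of $\mathbb{F}_q^*$, where $q$ is an odd prime. If $|A|\ge q^{\frac{9d+36}{28d}}$, then $|\Delta(A^d)|\gg q$.
   Context: $A^d=A\times\cdots\times A\subset\mathbb{F}_q^d$. For $\mathbf{x}\in\mathbb{F}_q^d$, $\|\mathbf{x}\|=x_1^2+\cdots+x_d^2$; for $E\subset\mathbb{F}_q^d$, $\Delta(E)=\{\|\mathbf{x}-\mathbf{y}\|:\mathbf{x},\mathbf{y}\in E\}$. The notation $X\gg Y$ means $X\ge cY$ for a constant $c>0$ not depending on $q$ or $A$ (it may depend on $d$). *)

(* Defs.v *)
From HB Require Import structures.
From mathcomp Require Import all_boot all_order all_fingroup all_algebra.

Set Implicit Arguments.
Unset Strict Implicit.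
Unset Printing Implicit Defensive.

Import GRing.Theory.
Local Open Scope ring_scope.

(* ||x|| = x_1^2 + ... + x_d^2; no square root is taken, the value is in F. *)
Definition sqnorm (F : finFieldType) (d : nat) (x : 'rV[F]_d) : F :=
  \sum_(i < d) x ord0 i ^+ 2.

Definition distance_set (F : finFieldType) (d : nat) (E : {set 'rV[F]_d}) :
    {set F} :=
  [set sqnorm (x - y) | x in E, y in E].

Definition cart_power (F : finFieldType) (d : nat) (A : {set F}) :
    {set 'rV[F]_d} :=
  [set x : 'rV[F]_d | [forall i : 'I_d, x ord0 i \in A]].

(* Subgroups of F^* live in the group type {unit F}; this is the underlying
   subset of F, on which differences can be formed. *)
Definition units_image (F : finFieldType) (A : {group {unit F}}) : {set F} :=
  [set FinRing.uval u | u in A].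

(* Main.v *)
(** Let n = |A|, let G be the subgroup of the squares of A, and let
    D = {(a - b)^2 : a, b in A}.  The distance set of A^d is the d-fold sumset
    of D, and D is invariant under multiplication by G.

    If X is G-invariant, all the nontrivial Fourier coefficients of its
    indicator are at most (q|X|/|G|)^(1/2), so the j-fold sumset of X covers a
    positive proportion of F_q as soon as |X|^j |G|^(j-1) >> q^j.  It remains to
    find a large G-invariant X inside a k-fold sumset of D with jk <= d:
    - if n^3 >= q^2, the trivial bound |D| >= |G| suffices, with X = D;
    - Stepanov's method gives |X + G| >> |G| |X|^(1/2), hence |D| >> n^(3/2) and
      |D + D| >> n^(7/4).  The first of these suffices, with X = D, when d <= 14
      or n^2 >= q;
    - otherwise X is the 6-fold sumset of D: the pivot argument of Glibichuk and
      Konyagin gives |3D - 3D| >> min(n^(5/2), q), and Ruzsa's triangle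
      inequality gives |6D|^2 >= |3D - 3D| |3D|. *)

Require Import Defs.
From HB Require Import structures.
From mathcomp Require Import all_boot all_order all_fingroup all_algebra.
From mathcomp Require Import reals exp.
From mathcomp Require Import zify ring lra.

Set Implicit Arguments.
Unset Strict Implicit.
Unset Printing Implicit Defensive.

Import Order.TTheory GRing.Theory Num.Theory.
Local Open Scope ring_scope.

(** * Stepanov's method *)

Lemma underdetermined_system (F : fieldType) (I E : finType) (c : I -> E -> F) :
  (#|E| < #|I|)%N ->
  exists2 lam : I -> F, exists i, lam i != 0 &
    forall e, \sum_i lam i * c i e = 0.
Proof.
move=> ltEI.
pose M := \matrix_(i < #|I|, e < #|E|) c (enum_val i) (enum_val e).
have kn0 : kermx M != 0.
  rewrite -mxrank_eq0 mxrank_ker -lt0n subn_gt0.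
  exact: leq_ltn_trans (rank_leq_col M) ltEI.
pose v := nz_row (kermx M).
have v0 : v != 0 by rewrite nz_row_eq0.
have vM : v *m M = 0 by apply/sub_kermxP; exact: nz_row_sub.
exists (fun i => v 0 (enum_rank i)).
  case/rV0Pn: v0 => i vi; exists (enum_val i); by rewrite enum_valK.
move=> e; move/rowP/(_ (enum_rank e)): vM; rewrite !mxE => {2}<-.
rewrite (reindex_onto (@enum_val I predT) enum_rank) /=; last first.
  by move=> i _; rewrite enum_rankK.
apply: eq_big => [i|i _]; first by rewrite enum_valK eqxx.
by rewrite enum_valK mxE enum_rankK.
Qed.

(** * The derivation X(1 - X) d/dX on polynomials *)

Section StepanovOperator.
Variable F : fieldType.
Implicit Types (f g h r Q : {poly F}) (w : F).

(** Modulo [Q] only the term of index 0 survives, so [Q] divides [Phi ord0], which is therefore 0;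
    cancelling one factor [Q] lowers [b]. *)
Lemma expansion_in_powers_eq0 Q (b : nat) (Phi : 'I_b -> {poly F}) :
  Q != 0 -> (forall k, Q %| Phi k -> Phi k = 0) ->
  \sum_(k < b) Phi k * Q ^+ k = 0 -> forall k, Phi k = 0.
Proof.
move=> Q0; elim: b Phi => [Phi _ _ []//|b IH] Phi Hd.
rewrite big_ord_recl expr0 mulr1 => S0.
have SE : \sum_(i < b) Phi (lift ord0 i) * Q ^+ lift ord0 i =
          Q * \sum_(i < b) Phi (lift ord0 i) * Q ^+ i.
  by rewrite big_distrr /=; apply: eq_bigr => i _; rewrite /bump /= add1n exprS mulrCA.
have P0 : Phi ord0 = 0.
  apply: Hd => //; rewrite SE in S0; move/eqP: S0; rewrite addr_eq0 => /eqP /= ->.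
  by rewrite dvdpNr dvdp_mulr.
have T0 : \sum_(i < b) Phi (lift ord0 i) * Q ^+ i = 0.
  by move/eqP: S0; rewrite SE P0 add0r mulf_eq0 (negbTE Q0) => /eqP.
move=> k; case: (unliftP ord0 k) => [i ->|-> //].
by apply: (IH (fun k => Phi (lift ord0 k))) => // j; exact: Hd.
Qed.

(** At a point w with (w^t, (1 - w)^t) = (u, v) the value is u^j v^k w^i, of degree only i in w once
    u and v are fixed. *)
Definition stepanov_monomial (t i j k : nat) : {poly F} :=
  'X ^+ (t * j) * (1 - 'X) ^+ (t * k) * 'X ^+ i.

Lemma oneBX_neq0 : 1 - 'X != 0 :> {poly F}.
Proof. by rewrite -opprB oppr_eq0 polyXsubC_eq0. Qed.

(** The factor X(1 - X) lets the operator preserve the multiples of X^u (1 - X)^v, while away from 0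
    and 1 it still detects multiplicities. *)
Definition delta f : {poly F} := 'X * (1 - 'X) * f^`().

Lemma delta_is_linear : linear delta.
Proof.
by move=> c f g; rewrite /delta derivD derivZ mulrDr -scalerAr.
Qed.
HB.instance Definition _ :=
  GRing.isLinear.Build F {poly F} {poly F} _ delta delta_is_linear.

(** The conjugate of [delta] by X^u (1 - X)^v; u - (u + v)X is X(1 - X) times the logarithmic
    derivative of that product. *)
Definition twisted_delta (u v : nat) r : {poly F} :=
  (u%:R - (u + v)%:R * 'X) * r + delta r.

Lemma mulX_deriv_Xn n : 'X * ('X ^+ n)^`() = n%:R * 'X ^+ n :> {poly F}.
Proof.
rewrite derivXn; case: n => [|n]; first by rewrite mulr0n mulr0 mul0r.
by rewrite -mulr_natl mulrCA -exprS.
Qed.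

Lemma mul_deriv_oneBXn n :
  (1 - 'X) * ((1 - 'X) ^+ n)^`() = - n%:R * (1 - 'X) ^+ n :> {poly F}.
Proof.
rewrite deriv_exp derivB derivX derivC sub0r.
case: n => [|n]; first by rewrite mulr0n mulr0 oppr0 mul0r.
by rewrite /= exprS -mulr_natl; ring.
Qed.

Lemma delta_twist u v r :
  delta ('X ^+ u * (1 - 'X) ^+ v * r) =
  'X ^+ u * (1 - 'X) ^+ v * twisted_delta u v r.
Proof.
rewrite /delta /twisted_delta !derivM natrD.
transitivity (('X * ('X ^+ u)^`()) * ((1 - 'X) * (1 - 'X) ^+ v * r)
  + ('X * 'X ^+ u) * ((1 - 'X) * ((1 - 'X) ^+ v)^`() * r)
  + 'X ^+ u * (1 - 'X) ^+ v * ('X * (1 - 'X) * r^`())); first by ring.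
by rewrite mulX_deriv_Xn mul_deriv_oneBXn /delta; ring.
Qed.

Lemma iter_delta_twist n u v r :
  iter n delta ('X ^+ u * (1 - 'X) ^+ v * r) =
  'X ^+ u * (1 - 'X) ^+ v * iter n (twisted_delta u v) r.
Proof. by elim: n => //= n ->; rewrite delta_twist. Qed.

Lemma size_delta r : (size (delta r) <= (size r).+1)%N.
Proof.
rewrite /delta; case: (eqVneq r^`() 0) => [->|r0]; first by rewrite mulr0 size_poly0.
have := lt_size_deriv (_ : r != 0).
have rn0 : r != 0 by apply: contraNneq r0 => ->; rewrite deriv0.
move/(_ rn0) => lt.
apply: leq_trans (size_polyMleq _ _) _.
have : (size ('X * (1 - 'X) : {poly F})%R <= 3)%N.
  apply: leq_trans (size_polyMleq _ _) _.
  by rewrite size_polyX -opprB size_polyN size_XsubC.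
by move: lt; do 3!(move: (size _) => ?); lia.
Qed.

Lemma size_iter_twisted n u v r :
  (size (iter n (twisted_delta u v) r) <= size r + n)%N.
Proof.
elim: n => [|n IH]; first by rewrite addn0.
rewrite iterS; apply: (leq_trans (n := (size (iter n (twisted_delta u v) r)).+1));
  last by rewrite addnS ltnS.
set g := iter _ _ _; rewrite /twisted_delta.
apply: leq_trans (size_polyD _ _) _; rewrite geq_max size_delta andbT.
apply: leq_trans (size_polyMleq _ _) _.
have : (size (u%:R - (u + v)%:R * 'X : {poly F})%R <= 2)%N.
  apply: leq_trans (size_polyD _ _) _; rewrite size_polyN geq_max.
  rewrite -!polyC_natr (leq_trans (size_polyC_leq1 _)) //=.
  apply: leq_trans (size_polyMleq _ _) _; rewrite size_polyX.
  by have := size_polyC_leq1 ((u + v)%:R : F); move: (size _) => ?; lia.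
by do 2!(move: (size _) => ?); lia.
Qed.

(** Each application removes at most one factor ['X - w%:P]; the part in which none is lost
    contributes 0 at [w]. *)
Lemma horner_iter_delta k h w :
  (iter k delta (('X - w%:P) ^+ k * h)).[w] = k`!%:R * (w * (1 - w)) ^+ k * h.[w].
Proof.
elim: k h => [|k IH] h; first by rewrite /= !expr0 !mul1r.
rewrite iterSr.
have -> : delta (('X - w%:P) ^+ k.+1 * h) =
  ('X - w%:P) ^+ k * (k.+1%:R * ('X * (1 - 'X)) * h + ('X - w%:P) * delta h).
  rewrite /delta derivM deriv_exp derivXsubC mul1r /= exprS -mulr_natl; ring.
rewrite IH factS natrM exprS -polyC_natr hornerD [X in _ * (_ + X)]hornerM.
rewrite hornerXsubC subrr mul0r !(hornerM, hornerD, hornerN, hornerX, hornerC).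
by ring.
Qed.

Lemma dvdp_prod_XsubC_exp (s : seq F) m f :
  uniq s -> (forall w, w \in s -> ('X - w%:P) ^+ m %| f) ->
  \prod_(w <- s) ('X - w%:P) ^+ m %| f.
Proof.
elim: s => [|w s IH] /=; first by rewrite big_nil dvd1p.
case/andP=> ws us Hs; rewrite big_cons Gauss_dvdp.
  by rewrite Hs ?mem_head // IH // => z zs; apply: Hs; rewrite inE zs orbT.
elim: s ws {us IH Hs} => [|z s IH]; first by rewrite big_nil coprimep1.
rewrite inE negb_or => /andP[wz ws]; rewrite big_cons coprimepMr IH // andbT.
by rewrite coprimep_expl // coprimep_expr // coprimep_XsubC2 // subr_eq0 eq_sym.
Qed.
End StepanovOperator.
Arguments delta {F} f.
Arguments stepanov_monomial {F} t i j k.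

(** * Independence of the Stepanov monomials, and orders of vanishing modulo p *)

Section Stepanov.
Variable p : nat.
Hypothesis p_pr : prime p.
Local Notation F := 'F_p.
Implicit Types (f g h r Q : {poly F}) (w : F).

Lemma natrFp_eq0 k : (k%:R == 0 :> F) = (p %| k)%N.
Proof. by rewrite (dvdn_pcharf (pchar_Fp p_pr)). Qed.

Lemma natrFp_small_eq0 k : (k < p)%N -> (k%:R == 0 :> F) = (k == 0)%N.
Proof.
move=> kp; rewrite natrFp_eq0; case: k kp => [|k] kp; first by rewrite dvdn0.
by apply/negbTE; rewrite gtnNdvd.
Qed.

Lemma natrFp_inj i k : (i < p)%N -> (k < p)%N -> i%:R = k%:R :> F -> i = k.
Proof.
wlog ik : i k / (i <= k)%N => [H ip kp e|ip kp e].
  by case/orP: (leq_total i k) => ?; [exact: H|symmetry; exact: H].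
apply/eqP; rewrite eqn_leq ik /= -subn_eq0 -natrFp_small_eq0.
  by rewrite natrB // e subrr.
by apply: leq_ltn_trans kp; exact: leq_subr.
Qed.

(* [X f' - k f] has one term less than [f] but loses only one factor [X - 1]. *)
Lemma sparse_poly_eq0 (s : seq nat) f :
  all (fun i => i < p)%N s -> (forall i, i \notin s -> f`_i = 0) ->
  ('X - 1%:P) ^+ size s %| f -> f = 0.
Proof.
elim: s f => [|k s IH] f /= => [_ fs _|/andP[kp sp] fs dvdf].
  by apply/polyP => i; rewrite coef0 fs.
pose g := 'X * f^`() - k%:R *: f.
have gE i : g`_i = (i%:R - k%:R) * f`_i.
  rewrite /g coefB coefZ coefXM coef_deriv mulrBl; congr (_ - _).
  by case: i => [|i]; rewrite ?mul0r //= mulr_natl.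
have g0 : g = 0.
  apply: IH => // [i is_|].
    rewrite gE; case: (eqVneq i k) => [->|ik]; first by rewrite subrr mul0r.
    by rewrite fs ?mulr0 // inE negb_or ik.
  case/dvdpP: dvdf => h fE.
  rewrite /g fE derivM deriv_exp derivXsubC mul1r.
  rewrite /= dvdp_sub // ?dvdp_mull // -?mul_polyC.
    rewrite dvdp_add ?dvdp_mull //.
      by rewrite exprS dvdp_mull.
    by rewrite -mulr_natl dvdp_mull.
  by rewrite exprS !dvdp_mull.
have fi i : i != k -> f`_i = 0.
  move=> ik; case: (boolP (i \in s)) => [is_|nis]; last first.
    by rewrite fs // inE negb_or ik.
  have /eqP := gE i; rewrite g0 coef0 eq_sym mulf_eq0 subr_eq0.
  case/orP => [/eqP e|/eqP //].
  by move: ik; rewrite (natrFp_inj (allP sp _ is_) kp e) eqxx.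
have fE : f = f`_k *: 'X^k.
  apply/polyP => i; rewrite coefZ coefXn.
  by case: (eqVneq i k) => [->|/fi ->]; rewrite ?mulr1 ?mulr0.
have : root f 1.
  rewrite -dvdp_XsubCl; apply: dvdp_trans dvdf.
  by rewrite exprS dvdp_mulr.
rewrite rootE fE !hornerE expr1n mulr1 => /eqP ->.
by rewrite scale0r.
Qed.

(** Group the relation by powers of (1 - X)^t. Each [Phi k] has at most ab monomials, all of degree
    below p, so if (1 - X)^t divides it, it is 0 by [sparse_poly_eq0]; hence every [Phi k] is 0. The
    exponents i + tj are distinct because i < a <= t. *)
Lemma stepanov_independent (t a b : nat)
    (lam : 'I_a * 'I_b * 'I_b -> F) :
  (a * b <= t)%N -> (t * b <= p)%N ->
  \sum_x lam x *: stepanov_monomial t x.1.1 x.1.2 x.2 = 0 ->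
  forall x, lam x = 0.
Proof.
move=> abt tbp S0 [[i0 j0] k0].
have a0 : (0 < a)%N by case: (a) i0 => [[]|].
have b0 : (0 < b)%N by case: (b) j0 => [[]|].
have at_ : (a <= t)%N by apply: leq_trans abt; rewrite leq_pmulr.
have t0 : (0 < t)%N by apply: leq_trans at_.
pose Phi (k : 'I_b) := \sum_(x : 'I_a * 'I_b) lam (x, k) *: 'X ^+ (x.1 + t * x.2).
have coefPhi k n : (Phi k)`_n =
    \sum_(x : 'I_a * 'I_b) lam (x, k) * (n == x.1 + t * x.2)%N%:R.
  by rewrite coef_sum; apply: eq_bigr => x _; rewrite coefZ coefXn.
have Phi0 k : Phi k = 0.
  move: k; apply: (@expansion_in_powers_eq0 _ ((1 - 'X) ^+ t)).
  - by rewrite expf_neq0 // oneBX_neq0.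
  - move=> k dvd.
    pose s := [seq (x + t * y)%N | x <- iota 0 a, y <- iota 0 b].
    apply: (@sparse_poly_eq0 s).
    + apply/allP => n /allpairsP[[x y]] /=; rewrite !mem_iota !add0n /= => -[xa yb ->].
      apply: leq_trans tbp; case: (b) yb => // c yc.
      rewrite mulnS -addSn; apply: leq_add; first exact: leq_trans xa at_.
      by rewrite leq_mul2l -[(y <= c)%N]/(y < c.+1)%N yc orbT.
    + move=> n ns; rewrite coefPhi big1 // => -[x y] _ /=.
      case: eqP => [E|_]; last by rewrite mulr0.
      case/negP: ns; apply/allpairsP; exists (nat_of_ord x, nat_of_ord y).
      by rewrite !mem_iota !add0n !ltn_ord.
    + rewrite size_allpairs !size_iota; apply: dvdp_trans dvd.
      rewrite -[1 - 'X]opprB exprNn dvdp_mull // -(subnK abt) exprD.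
      exact: dvdp_mull.
  rewrite -[RHS]S0; transitivity (\sum_k \sum_(x : 'I_a * 'I_b)
      lam (x, k) *: stepanov_monomial t x.1 x.2 k); last first.
    by rewrite exchange_big pair_bigA; apply: eq_bigr => -[].
  apply: eq_bigr => k _; rewrite big_distrl; apply: eq_bigr => x _ /=.
  rewrite /stepanov_monomial -scalerAl exprD -exprM; congr (_ *: _).
  by ring.
have := coefPhi k0 (i0 + t * j0)%N; rewrite Phi0 coef0.
rewrite (bigD1 (i0, j0)) //= eqxx mulr1 big1 ?addr0 => [->//|[x y] /=].
move=> ne; case: eqP => [E|_]; last by rewrite mulr0.
case/negP: ne; rewrite xpair_eqE.
have m z u : (z < a)%N -> ((z + t * u) %% t = z)%N.
  by move=> za; rewrite addnC mulnC modnMDl modn_small // (leq_trans za).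
have ix : i0 = x :> nat by rewrite -(m i0 j0) // E m.
move/eqP: E; rewrite ix eqn_add2l eqn_pmul2l // => E.
by apply/andP; split; apply/eqP/val_inj => //=; rewrite ?ix //; apply/eqP; rewrite eq_sym.
Qed.

(** Induction on [m]: if f = (X - w)^m h, the m-th iterate at w is m! (w(1 - w))^m h(w), and m! is
    invertible since m < p. *)
Lemma dvdp_of_iter_delta f w m :
  w != 0 -> w != 1 -> (m <= p)%N ->
  (forall k, (k < m)%N -> (iter k delta f).[w] = 0) -> ('X - w%:P) ^+ m %| f.
Proof.
move=> w0 w1; elim: m => [|m IH] mp Hk; first by rewrite expr0 dvd1p.
have /dvdpP[h fE] : ('X - w%:P) ^+ m %| f.
  by apply: IH => [|k km]; [exact: ltnW|apply: Hk; exact: ltnW].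
have := Hk m (ltnSn m); rewrite fE mulrC horner_iter_delta => /eqP.
rewrite !mulf_eq0 natrFp_eq0 expf_eq0 mulf_eq0 (negbTE w0) subr_eq0 eq_sym (negbTE w1).
rewrite andbF orbF.
have -> : (p %| m`!)%N = false.
  apply/negbTE; rewrite -prime_coprime // coprime_sym.
  elim: (m) mp => [|n IHn] np; first by rewrite coprime1n.
  rewrite factS coprimeMl IHn ?andbT; last exact: ltnW.
  by rewrite coprime_sym prime_coprime // gtnNdvd.
rewrite /= => hw; rewrite exprS mulrC dvdp_mul ?dvdpp //.
by rewrite dvdp_XsubCl.
Qed.

End Stepanov.

(** * Counting points w with prescribed pairs of t-th powers of w and 1 - w *)

Section StepanovCount.
Variable p : nat.
Hypothesis p_pr : prime p.
Local Notation F := 'F_p.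

Definition power_pair_fiber (t : nat) (P : {set F * F}) : {set F} :=
  [set w | [&& w != 0, w != 1 & (w ^+ t, (1 - w) ^+ t) \in P]].

Lemma size_stepanov_monomial (t a b i j k : nat) :
  (i < a)%N -> (j < b)%N -> (k < b)%N ->
  (size (stepanov_monomial t i j k : {poly F}) <= a + 2 * t * b)%N.
Proof.
move=> ia jb kb; rewrite /stepanov_monomial.
apply: leq_trans (size_polyMleq _ _) _; rewrite size_polyXn addnS /=.
have s1 : (size ('X ^+ (t * j) * (1 - 'X) ^+ (t * k) : {poly F})%R <= (t * j + t * k).+1)%N.
  apply: leq_trans (size_polyMleq _ _) _; rewrite size_polyXn addSn /=.
  rewrite -opprB exprNn -signr_odd mulr_sign.
  by case: odd; rewrite ?size_polyN size_exp_XsubC addnS.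
have h1 : (t * j + t <= t * b)%N by rewrite -mulnSr leq_mul2l jb orbT.
have h2 : (t * k + t <= t * b)%N by rewrite -mulnSr leq_mul2l kb orbT.
by move: (size _) s1 => z s1; nia.
Qed.

(* There are more coefficients [a b^2] in the auxiliary polynomial than linear
   conditions [2 |P| a^2] forcing it to vanish to order [a] on the fiber. *)
Lemma power_pair_fiber_bound (t a b : nat) (P : {set F * F}) :
  (a * b <= t)%N -> (t * b <= p)%N -> (2 * #|P| * a < b ^ 2)%N ->
  (#|power_pair_fiber t P| * a <= a + 2 * t * b)%N.
Proof.
move=> abt tbp lt; case: (posnP a) => [->|a0]; first by rewrite muln0.
have b0 : (0 < b)%N by case: (b) lt.
have t0 : (0 < t)%N by apply: leq_trans abt; rewrite muln_gt0 a0.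
have ap : (a <= p)%N.
  apply: leq_trans (_ : a <= a * b)%N _; first by rewrite leq_pmulr.
  by apply: leq_trans abt _; apply: leq_trans tbp; rewrite leq_pmulr.
(* A condition is a pair of [P], an order k < a and a coefficient index below 2a: once the t-th
   powers are replaced by the pair, the k-th iterate becomes a polynomial in w of size at most 2a,
   and all its coefficients are made to vanish. *)
pose c (x : 'I_a * 'I_b * 'I_b) (e : 'I_#|P| * 'I_a * 'I_(a + a)) : F :=
  (enum_val e.1.1).1 ^+ x.1.2 * (enum_val e.1.1).2 ^+ x.2 *
  (iter e.1.2 (twisted_delta (t * x.1.2) (t * x.2)) 'X^(x.1.1))`_e.2.
have [|lam [x0 lamx0] Hlam] := underdetermined_system c.
  rewrite !card_prod !card_ord; move: lt; rewrite -(ltn_pmul2l a0); lia.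
pose Psi := \sum_x lam x *: stepanov_monomial t x.1.1 x.1.2 x.2.
have Psi0 : Psi != 0.
  apply: contraNneq lamx0 => S0; apply/eqP.
  exact: (stepanov_independent p_pr abt tbp S0).
have iterD k : iter k delta Psi =
    \sum_x lam x *: iter k delta (stepanov_monomial t x.1.1 x.1.2 x.2).
  elim: k => [//|k IH] /=; rewrite IH linear_sum; apply: eq_bigr => x _.
  by rewrite linearZ.
have vanish w : w \in power_pair_fiber t P -> ('X - w%:P) ^+ a %| Psi.
  rewrite inE => /and3P[w0 w1 wP]; apply: dvdp_of_iter_delta => // k ka.
  pose r := \sum_x (lam x * (w ^+ t) ^+ x.1.2 * ((1 - w) ^+ t) ^+ x.2) *:
    iter k (twisted_delta (t * x.1.2) (t * x.2)) 'X^(x.1.1) : {poly F}.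
  have r0 : r = 0.
    apply/polyP => l; rewrite coef0 coef_sum.
    case: (ltnP l (a + a)) => la.
      rewrite -[RHS](Hlam (enum_rank_in wP (w ^+ t, (1 - w) ^+ t), Ordinal ka, Ordinal la)).
      apply: eq_bigr => x _; rewrite /c /= enum_rankK_in //= coefZ.
      by rewrite !mulrA.
    rewrite big1 // => x _; rewrite coefZ nth_default ?mulr0 //.
    apply: leq_trans (size_iter_twisted _ _ _ _) _; rewrite size_polyXn.
    by apply: leq_trans la; have := ltn_ord x.1.1; lia.
  rewrite -(horner0 w) -r0 iterD !horner_sum; apply: eq_bigr => x _.
  rewrite /stepanov_monomial iter_delta_twist !hornerZ !hornerM horner_exp.
  rewrite !(hornerXn, horner_exp, hornerD, hornerN, hornerX, hornerC).
  by rewrite -!exprM; ring.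
(* Every point of the fiber is a root of order at least [a], and the total cannot exceed the degree
   of [Psi]. *)
have := dvdp_prod_XsubC_exp (enum_uniq (mem (power_pair_fiber t P)))
  (fun w H => vanish w (etrans (esym (mem_enum _ _)) H)).
move/dvdp_leq => /(_ Psi0) sz.
have sPsi : (size Psi <= a + 2 * t * b)%N.
  apply: leq_trans (size_sum _ _ _) _; apply/bigmax_leqP => x _.
  apply: leq_trans (size_scale_leq _ _) _.
  exact: size_stepanov_monomial.
have := leq_trans sz sPsi.
rewrite size_prod_seq => [|w _]; last by rewrite expf_neq0 // polyXsubC_eq0.
rewrite (eq_bigr (fun=> a.+1)) => [|w _]; last by rewrite size_exp_XsubC.
rewrite big_enum sum_nat_const -cardE. rewrite -![#|mem _|]/#|power_pair_fiber t P|; nia.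
Qed.
End StepanovCount.

(* The choice [a ~ (t^2 / 8J)^(1/3)], [b ~ t / a] balances the two terms. *)
Lemma power_pair_fiber_cube_bound p t J (P : {set 'F_p * 'F_p}) :
  prime p -> (0 < J)%N -> (#|P| <= J)%N ->
  (8 * J < t ^ 2)%N -> (64 * J * t ^ 4 <= p ^ 3)%N ->
  ((#|power_pair_fiber t P| - 1) ^ 3 <= 2 ^ 15 * J ^ 2 * t ^ 2)%N.
Proof.
move=> p_pr J0 PJ Jt Jp.
have t0 : (0 < t)%N by case: (t) Jt.
(* [a] is taken largest with 8 J a^3 < t^2; maximality gives the reverse inequality up to a factor
   8, because a + 1 <= 2a. *)
have ex1 : exists a, (8 * J * a ^ 3 < t ^ 2)%N by exists 1%N; rewrite exp1n muln1.
have bnd a : (8 * J * a ^ 3 < t ^ 2 -> a <= t ^ 2)%N.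
  case: (posnP a) => [->//|a0] /ltnW h; apply: leq_trans h; rewrite expnS mulnCA.
  by rewrite leq_pmulr // !muln_gt0 J0 a0.
case: (ex_maxnP ex1 bnd) => a aP amax.
have a0 : (0 < a)%N by apply: amax; rewrite exp1n muln1.
have aS : (t ^ 2 <= 64 * J * a ^ 3)%N.
  have h : (t ^ 2 <= 8 * J * a.+1 ^ 3)%N.
    by rewrite leqNgt; apply/negP => /amax; rewrite ltnn.
  apply: leq_trans h _; rewrite (_ : 64 * J * a ^ 3 = 8 * J * (2 * a) ^ 3)%N.
    by rewrite leq_mul2l leq_exp2r //; apply/orP; right; lia.
  by rewrite expnMn; ring.
have at_ : (a <= t)%N.
  rewrite leqNgt; apply/negP => ta; move: aP; rewrite ltnNge => /negP; apply.
  have h : (t ^ 2 <= a ^ 2)%N by rewrite leq_exp2r // ltnW.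
  apply: leq_trans h _; rewrite (expnS a 2) mulnA leq_pmull //.
  by rewrite !muln_gt0 J0 a0.
pose b := (t %/ a)%N.
have abt : (a * b <= t)%N by rewrite mulnC leq_trunc_div.
have tab : (t <= 2 * (a * b))%N.
  have := ltn_ceil t a0; have : (0 < b)%N by rewrite divn_gt0.
  by rewrite -/b; nia.
have abJ : (2 * J * a < b ^ 2)%N.
  rewrite -(@ltn_pmul2l (4 * a ^ 2)) ?muln_gt0 ?expn_gt0 ?a0 //.
  have -> : (4 * a ^ 2 * (2 * J * a) = 8 * J * a ^ 3)%N by rewrite !expnS expn0; ring.
  apply: leq_trans aP _.
  have -> : (4 * a ^ 2 * b ^ 2 = (2 * (a * b)) ^ 2)%N by rewrite !expnMn; ring.
  by rewrite leq_exp2r.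
have tbp : (t * b <= p)%N.
  rewrite -(leq_pmul2r a0) -(@leq_exp2r _ _ 3) //.
  apply: (@leq_trans ((t ^ 2) ^ 3)).
    by rewrite leq_exp2r // expnS expn1 -mulnA leq_mul2l [(b * a)%N]mulnC abt orbT.
  rewrite expnMn; apply: leq_trans (leq_mul Jp (leqnn _)).
  have -> : ((t ^ 2) ^ 3 = t ^ 4 * t ^ 2)%N by rewrite -expnM -expnD.
  rewrite (_ : 64 * J * t ^ 4 * a ^ 3 = t ^ 4 * (64 * J * a ^ 3))%N; last by ring.
  by rewrite leq_mul2l aS orbT.
have abP : (2 * #|P| * a < b ^ 2)%N.
  by apply: leq_ltn_trans abJ; rewrite leq_mul2r leq_mul2l PJ !orbT.
have := power_pair_fiber_bound p_pr abt tbp abP.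
set M := #|_| => HM.
have H1 : ((M - 1) * a ^ 2 <= 2 * t ^ 2)%N.
  have h : ((M - 1) * a <= 2 * t * b)%N by rewrite mulnBl mul1n leq_subLR.
  have := leq_mul h (leqnn a); rewrite -!mulnA => h2; apply: leq_trans h2 _.
  by rewrite leq_mul2l /= leq_mul2l [(b * a)%N]mulnC abt orbT.
(* Since t^4 <= (64 J a^3)^2, multiplying by t^4 makes ((M - 1) a^2)^3 appear and [a] disappear. *)
rewrite -(@leq_pmul2r (t ^ 4)) ?expn_gt0 ?t0 //.
apply: (@leq_trans ((M - 1) ^ 3 * (64 * J * a ^ 3) ^ 2)).
  by rewrite leq_mul2l (expnM t 2 2) leq_exp2r // aS orbT.
have -> : ((M - 1) ^ 3 * (64 * J * a ^ 3) ^ 2 = ((M - 1) * a ^ 2) ^ 3 * (2 ^ 12 * J ^ 2))%N.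
  by move: (M - 1)%N => m; ring.
have -> : (2 ^ 15 * J ^ 2 * t ^ 2 * t ^ 4 = (2 * t ^ 2) ^ 3 * (2 ^ 12 * J ^ 2))%N.
  by ring.
by rewrite leq_mul2r leq_exp2r // H1 orbT.
Qed.

(** * Sumsets with a multiplicative subgroup *)

Section Sumsets.
Variable F : finFieldType.
Implicit Types (G X Y Z : {set F}).

Definition sumset X Y : {set F} := [set x + y | x in X, y in Y].

Definition stable_under G X := forall g x, g \in G -> x \in X -> g * x \in X.

Lemma mem_sumset X Y x y : x \in X -> y \in Y -> x + y \in sumset X Y.
Proof. exact: imset2_f. Qed.

Lemma stable_sumset G X Y :
  stable_under G X -> stable_under G Y -> stable_under G (sumset X Y).
Proof.
move=> sX sY g _ gG /imset2P[x y xX yY ->].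
by rewrite mulrDr mem_sumset ?sX ?sY.
Qed.

(** The map x -> x^t is constant on each coset xG, so its fibers on [X] have at least |G|
    elements. *)
Lemma card_power_image G X t :
  (forall g, g \in G -> g ^+ t = 1) -> 0 \notin X -> stable_under G X ->
  (#|G| * #|[set x ^+ t | x in X]| <= #|X|)%N.
Proof.
move=> Gt X0 sX; set U := [set _ | _ in X].
rewrite -[leqRHS](sum1_card (mem X)) (partition_big_imset (fun x => x ^+ t)) /=.
rewrite mulnC -sum_nat_const.
apply: leq_sum => u /imsetP[x xX ->]; rewrite sum1dep_card.
have x0 : x != 0 by apply: contraNneq X0 => <-.
rewrite -(card_imset _ (mulIf x0)); apply/subset_leq_card/subsetP => y.
case/imsetP=> g gG ->; rewrite inE sX //=.
by rewrite exprMn (Gt g) // mul1r.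
Qed.
End Sumsets.

(* For [w = x / (x + 1)] with [x] in [X], the pair [(w^t, (1 - w)^t)] only depends
   on the cosets of [x] and of [x + 1], hence takes few values. *)
Lemma sumset_subgroup_bound p (G X : {set 'F_p}) :
  prime p -> 1 \in G -> 0 \notin G -> stable_under G G ->
  (forall g, g \in G -> g ^+ #|G| = 1) -> stable_under G X ->
  0 \notin X -> (4 <= #|X|)%N ->
  (8 * (#|X| * #|sumset X G|) < #|G| ^ 4)%N ->
  (64 * (#|X| * #|sumset X G|) * #|G| ^ 2 <= p ^ 3)%N ->
  (#|G| ^ 2 * #|X| <= 2 ^ 18 * #|sumset X G| ^ 2)%N.
Proof.
move=> p_pr G1 G0 sG Gt sX X0 X4 small smallp.
set t := #|G| in Gt small smallp *.
have t0 : (0 < t)%N by rewrite card_gt0; apply/set0Pn; exists 1.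
pose Z := sumset X G :\ 0.
have ZS : (#|Z| <= #|sumset X G|)%N by rewrite subset_leq_card // subsetDl.
have sZ : stable_under G Z.
  move=> g z gG; rewrite !in_setD1 => /andP[z0 zS].
  rewrite (stable_sumset sX sG) // andbT mulf_neq0 //.
  by apply: contraNneq G0 => <-.
pose U := [set x ^+ t | x in X]; pose V := [set z ^+ t | z in Z].
have UX : (t * #|U| <= #|X|)%N by apply: card_power_image.
have VZ : (t * #|V| <= #|sumset X G|)%N.
  by apply: leq_trans ZS; apply: card_power_image => //; rewrite !inE eqxx.
pose P := [set (u / v, v^-1) | u in U, v in V].
have xZ x : x \in X -> x != -1 -> x + 1 \in Z.
  by move=> xX x1; rewrite in_setD1 addr_eq0 x1 mem_sumset.
(* The point x = -1, where x + 1 vanishes, is left out at the cost of one element. *)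
have sub : [set x / (x + 1) | x in X :\ -1] \subset power_pair_fiber t P.
  apply/subsetP => _ /imsetP[x /setD1P[x1 xX] ->]; rewrite inE.
  have x0 : x != 0 by apply: contraNneq X0 => <-.
  have z0 : x + 1 != 0 by rewrite addr_eq0.
  have E : 1 - x / (x + 1) = (x + 1)^-1 by field.
  rewrite mulf_neq0 ?invr_eq0 //= E.
  apply/andP; split.
    by rewrite -subr_eq0 -opprB oppr_eq0 E invr_eq0.
  rewrite exprMn exprVn; apply/imset2P.
  exists (x ^+ t) ((x + 1) ^+ t) => //; first exact: imset_f.
  by apply: imset_f; apply: xZ.
have inj : {in X :\ -1 &, injective (fun x => x / (x + 1))}.
  move=> x y /setD1P[x1 _] /setD1P[y1 _] /eqP.
  rewrite eqr_div ?addr_eq0 // !mulrDr !mulr1 mulrC (inj_eq (addrI _)).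
  by move/eqP.
have cardX : (#|X| - 1 <= #|power_pair_fiber t P|)%N.
  apply: leq_trans (subset_leq_card sub); rewrite card_in_imset //.
  by rewrite leq_subLR (cardsD1 (-1) X) leq_add2r leq_b1.
have X1 : leq 2 #|X :\ -1|.
  rewrite -(leq_add2l ((-1 : 'F_p) \in X)) -cardsD1; apply: leq_trans X4.
  by case: (_ \in X).
have [x xX1] : exists x, x \in X :\ -1 by apply/set0Pn; rewrite -card_gt0 ltnW.
have [x1 xX] := setD1P xX1.
have J0 : (0 < #|U| * #|V|)%N.
  rewrite muln_gt0 !card_gt0; apply/andP; split; apply/set0Pn.
    by exists (x ^+ t); apply: imset_f.
  by exists ((x + 1) ^+ t); apply/imset_f/xZ.
have PJ : (#|P| <= #|U| * #|V|)%N.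
  rewrite -cardsX.
  apply: leq_trans (leq_imset_card (fun u => (u.1 / u.2, u.2^-1)) _).
  apply/subset_leq_card/subsetP => _ /imset2P[u v uU vV ->].
  by apply/imsetP; exists (u, v); rewrite // inE uU.
have Jt : (#|U| * #|V| * t ^ 2 <= #|X| * #|sumset X G|)%N.
  by have := leq_mul UX VZ; rewrite mulnACA mulnn mulnC.
have H1 : (8 * (#|U| * #|V|) < t ^ 2)%N.
  rewrite -(@ltn_pmul2r (t ^ 2)) ?expn_gt0 ?t0 // -expnD -mulnA.
  by apply: leq_ltn_trans small; rewrite leq_mul2l.
have H2 : (64 * (#|U| * #|V|) * t ^ 4 <= p ^ 3)%N.
  apply: leq_trans smallp; rewrite -[4%N]/(2 + 2)%N expnD mulnA leq_mul2r.
  by rewrite -mulnA leq_mul2l Jt !orbT.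
have := power_pair_fiber_cube_bound p_pr J0 PJ H1 H2.
set J := (#|U| * #|V|)%N in J0 PJ Jt H1 H2 *.
set M := #|power_pair_fiber t P| in cardX *.
set s := #|sumset X G| in Jt *; set x' := #|X| in X4 cardX Jt *.
move=> HM.
(* One element is lost at x = -1 and one in the fiber bound, whence x' - 2. As x' >= 4, this is at
   least x' / 2, and the factor 2^3 will turn 2^15 into 2^18. *)
have H3 : (t ^ 2 * (x' - 2) ^ 3 <= 2 ^ 15 * (x' * s) ^ 2)%N.
  apply: (@leq_trans (t ^ 2 * (M - 1) ^ 3)).
    by rewrite leq_mul2l leq_exp2r //; apply/orP; right; lia.
  apply: (@leq_trans (2 ^ 15 * (J * t ^ 2) ^ 2)); last first.
    by rewrite leq_mul2l leq_exp2r // Jt orbT.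
  have -> : (2 ^ 15 * (J * t ^ 2) ^ 2 = t ^ 2 * (2 ^ 15 * J ^ 2 * t ^ 2))%N.
    by rewrite expnMn -expnM (expnD t 2 2); ring.
  by rewrite leq_mul2l HM orbT.
have x'0 : (0 < x')%N by lia.
rewrite -(@leq_pmul2r (x' ^ 2)) ?expn_gt0 ?x'0 //.
apply: (@leq_trans (2 ^ 3 * (t ^ 2 * (x' - 2) ^ 3))).
  rewrite -mulnA -expnS mulnCA leq_mul2l -expnMn leq_exp2r //.
  by apply/orP; right; lia.
have -> : (2 ^ 18 * s ^ 2 * x' ^ 2 = 2 ^ 3 * (2 ^ 15 * (x' * s) ^ 2))%N.
  by rewrite mulnA -expnD expnMn; ring.
by rewrite leq_mul2l H3.
Qed.

(** * Iterated sumsets of multiplicatively invariant sets *)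

(** Cauchy-Schwarz, read off from the nonnegative double sum of (f i - f j)^2. *)
Lemma sqr_sum_le_card (R : realDomainType) (T : finType) (A : {pred T}) (f : T -> R) :
  (\sum_(i in A) f i) ^+ 2 <= #|A|%:R * \sum_(i in A) f i ^+ 2.
Proof.
have : 0 <= \sum_(i in A) \sum_(j in A) (f i - f j) ^+ 2.
  by do 2!(apply: sumr_ge0 => ? _); rewrite sqr_ge0.
have E i j : (f i - f j) ^+ 2 = f i ^+ 2 + f j ^+ 2 + - 2 * (f i * f j) by ring.
under eq_bigr do under eq_bigr do rewrite E.
under eq_bigr do rewrite !big_split /= sumr_const -!mulr_sumr.
rewrite !big_split /= -!mulr_sumr -mulr_suml sumr_const sumrMnl.
set S := \sum_(i in A) f i; set Q := \sum_(i in A) _.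
rewrite -[Q *+ _]mulr_natl; nra.
Qed.

(** Cauchy-Schwarz for the fiber sizes of [f], whose squares add up to the number of colliding
    pairs. *)
Lemma card_imset_collisions (T U : finType) (f : T -> U) (S : {set T}) :
  (#|S| ^ 2 <= #|f @: S| * \sum_(u in S) \sum_(v in S) (f u == f v))%N.
Proof.
pose n (y : U) := (\sum_(u in S | f u == y) 1)%N.
have E1 : #|S| = (\sum_(y in f @: S) n y)%N.
  by rewrite -[LHS](sum1_card (mem S)) (partition_big_imset f).
have E2 : (\sum_(u in S) \sum_(v in S) (f u == f v) = \sum_(y in f @: S) n y ^ 2)%N.
  rewrite (partition_big_imset f) /=; apply: eq_bigr => y _.
  rewrite -[RHS]mulnn {1}/n big_distrl /=; apply: eq_bigr => u /andP[_ /eqP <-].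
  rewrite mul1n /n [RHS]big_mkcondr /=; apply: eq_bigr => v _.
  by rewrite eq_sym; case: eqP.
rewrite E2 E1 -(ler_nat rat) natrX natrM !natr_sum.
under [X in _ * X]eq_bigr do rewrite natrX.
exact: sqr_sum_le_card.
Qed.

Section Convolution.
Variables (R : realFieldType) (F : finFieldType).
Implicit Types (G X : {set F}) (h : F -> R).

Lemma dilate_stable G X g :
  0 \notin G -> stable_under G X -> g \in G -> [set g * x | x in X] = X.
Proof.
move=> G0 sX gG; have g0 : g != 0 by apply: contraNneq G0 => <-.
apply/eqP; rewrite eqEcard (card_imset _ (mulfI g0)) leqnn andbT.
by apply/subsetP => _ /imsetP[x xX ->]; exact: sX.
Qed.

(** For x != y the map (m, s) -> (s - mx, s - my) is a bijection of F^2, so the double sum is the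
    square of the sum of [h]. *)
Lemma sum_affine_pair_eq0 h (x y : F) :
  \sum_s h s = 0 -> x != y -> \sum_m \sum_s h (s - m * x) * h (s - m * y) = 0.
Proof.
move=> h0 xy; have yx0 : y - x != 0 by rewrite subr_eq0 eq_sym.
rewrite pair_bigA /=.
pose f (u : F * F) := (u.2 - u.1 * x, u.2 - u.1 * y).
pose g (v : F * F) := ((v.1 - v.2) / (y - x), v.1 + (v.1 - v.2) / (y - x) * x).
have fg : cancel f g by case=> m s; rewrite /f /g /=; congr (_, _); field.
have gf : cancel g f by case=> u v; rewrite /f /g /=; congr (_, _); field.
rewrite (reindex g) /=; last by exists f => ? _.
transitivity (\sum_(v : F * F) h v.1 * h v.2).
  apply: eq_bigr => v _.
  by have /= -> := congr1 fst (gf v); have /= -> := congr1 snd (gf v).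
by rewrite -(pair_bigA _ (fun u v => h u * h v)) /= -big_distrlr /= h0 mul0r.
Qed.

(* For a fixed [m] the inner sum is the squared norm of the convolution with
   [m X]; it is the same for all [m] in [G], and the average over all [m] in
   [F] only sees the diagonal. *)
Lemma convolution_norm_le G X h :
  0 \notin G -> stable_under G X -> \sum_s h s = 0 ->
  #|G|%:R * \sum_s (\sum_(x in X) h (s - x)) ^+ 2 <=
  #|F|%:R * #|X|%:R * \sum_s h s ^+ 2.
Proof.
move=> G0 sX h0; pose T m := \sum_s (\sum_(x in X) h (s - m * x)) ^+ 2.
have TG m : m \in G -> T m = \sum_s (\sum_(x in X) h (s - x)) ^+ 2.
  move=> mG; have m0 : m != 0 by apply: contraNneq G0 => <-.
  apply: eq_bigr => s _; congr (_ ^+ 2); rewrite -{2}(dilate_stable G0 sX mG).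
  by rewrite big_imset //= => ? ? _ _; apply: mulfI.
have -> : #|G|%:R * \sum_s (\sum_(x in X) h (s - x)) ^+ 2 = \sum_(m in G) T m.
  by rewrite (eq_bigr _ TG) sumr_const mulr_natl.
have T0 m : 0 <= T m by apply: sumr_ge0 => s _; rewrite sqr_ge0.
apply: (@le_trans _ _ (\sum_m T m)).
  by rewrite [leRHS](bigID (mem G)) /= lerDl sumr_ge0.
have -> : \sum_m T m =
    \sum_(x in X) \sum_(y in X) \sum_m \sum_s h (s - m * x) * h (s - m * y).
  transitivity (\sum_m \sum_s \sum_(x in X) \sum_(y in X) h (s - m * x) * h (s - m * y)).
    by apply: eq_bigr => m _; apply: eq_bigr => s _; rewrite expr2 big_distrlr.
  under eq_bigr do rewrite exchange_big /=.
  rewrite exchange_big /=; apply: eq_bigr => x _.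
  under eq_bigr do rewrite exchange_big /=.
  by rewrite exchange_big.
have E x : x \in X -> \sum_(y in X) \sum_m \sum_s h (s - m * x) * h (s - m * y) =
    #|F|%:R * \sum_s h s ^+ 2.
  move=> xX; rewrite (bigD1 x) //= [X in _ + X]big1 ?addr0 => [|y /andP[_ yx]].
    transitivity (\sum_(m : F) \sum_s h s ^+ 2); last by rewrite sumr_const mulr_natl.
    apply: eq_bigr => m _; rewrite (reindex_inj (addIr (m * x))) /=.
    by apply: eq_bigr => s _; rewrite addrK expr2.
  by apply: sum_affine_pair_eq0; rewrite // eq_sym.
by rewrite (eq_bigr _ E) sumr_const -mulrnAl -mulr_natr lexx.
Qed.

Definition iterated_sumset X n : {set F} := iter n (sumset X) [set 0].

Lemma stable_iterated_sumset G X n :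
  stable_under G X -> stable_under G (iterated_sumset X n).
Proof.
move=> sX; elim: n => [|n IH]; last exact: stable_sumset.
by move=> g x _ /set1P ->; rewrite mulr0 set11.
Qed.

(** The number of ordered n-tuples of elements of [X] with a given sum, valued in [R] so that its
    mean can be subtracted. *)
Definition sum_count X n : F -> R :=
  iter n (fun h s => \sum_(x in X) h (s - x)) (fun s => (s == 0)%:R).

Lemma sum_count0 X s : sum_count X 0 s = (s == 0)%:R.
Proof. by []. Qed.

Lemma sum_countS X n s :
  sum_count X n.+1 s = \sum_(x in X) sum_count X n (s - x).
Proof. by []. Qed.

Lemma sum_count_neq0 X n s : sum_count X n s != 0 -> s \in iterated_sumset X n.
Proof.
elim: n s => [|n IH] s.
  by rewrite /sum_count /iterated_sumset /= in_set1; case: (s == 0); rewrite ?eqxx.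
rewrite sum_countS.
move=> nz; have [x xX hx] : exists2 x, x \in X & sum_count X n (s - x) != 0.
  apply/exists_inP; apply: contraNT nz => /exists_inPn H.
  by rewrite big1 // => x /H; rewrite negbK => /eqP.
by rewrite -(subrKC x s) mem_sumset // IH.
Qed.

Lemma sum_sum_count X n : \sum_s sum_count X n s = #|X|%:R ^+ n.
Proof.
elim: n => [|n IH] /=.
  by rewrite (bigD1 0) //= eqxx big1 ?addr0 // => s /negbTE ->.
transitivity (\sum_s \sum_(x in X) sum_count X n (s - x)) => //.
rewrite exchange_big /= exprS -IH mulr_natl -sumr_const; apply: eq_bigr => x _.
by rewrite (reindex_inj (addIr x)); apply: eq_bigr => s _; rewrite addrK.
Qed.

(** The mean-square form of the Fourier coefficient bound: convolution with [X] preserves mean zero,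
    so by [convolution_norm_le] each step costs a factor q|X|/|G|. The base case is the variance of
    an indicator function. *)
Lemma centered_sum_count_norm_le G X n :
  0 \notin G -> stable_under G X ->
  #|G|%:R ^+ n *
    \sum_s (sum_count X n.+1 s - #|X|%:R ^+ n.+1 / #|F|%:R) ^+ 2 <=
  (#|F|%:R * #|X|%:R) ^+ n * #|X|%:R.
Proof.
move=> G0 sX; have F0 : #|F|%:R != 0 :> R.
  by rewrite pnatr_eq0 -lt0n; apply/card_gt0P; exists 0.
have zero_mean k : \sum_s (sum_count X k s - #|X|%:R ^+ k / #|F|%:R) = 0.
  by rewrite sumrB sum_sum_count sumr_const -[_ / _ *+ _]mulr_natr mulfVK // subrr.
have step k s : sum_count X k.+1 s - #|X|%:R ^+ k.+1 / #|F|%:R =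
    \sum_(x in X) (sum_count X k (s - x) - #|X|%:R ^+ k / #|F|%:R).
  by rewrite sumrB sumr_const -[_ / _ *+ _]mulr_natl mulrA -exprS.
elim: n => [|n IH].
  rewrite !expr0 !mul1r.
  have E s : (sum_count X 1 s - #|X|%:R ^+ 1 / #|F|%:R) ^+ 2 =
      (s \in X)%:R - 2 * (#|X|%:R / #|F|%:R) * (s \in X)%:R +
      (#|X|%:R / #|F|%:R) ^+ 2.
    have -> : sum_count X 1 s = (s \in X)%:R.
      rewrite sum_countS; under eq_bigr do rewrite sum_count0 subr_eq0.
      case: (boolP (s \in X)) => sX'.
        rewrite (bigD1 s) //= eqxx big1 ?addr0 // => x /andP[_ xs].
        by rewrite eq_sym (negbTE xs).
      rewrite big1 // => x xX; case: eqP => // E.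
      by rewrite E xX in sX'.
    by rewrite expr1; case: (s \in X) => /=; ring.
  rewrite (eq_bigr _ (fun s _ => E s)) !big_split /= sumrN -mulr_sumr.
  have -> : \sum_s (s \in X)%:R = #|X|%:R :> R.
    by rewrite -[RHS]sumr_const [RHS]big_mkcond; apply: eq_bigr => s _; case: ifP.
  rewrite sumr_const -[_ ^+ 2 *+ _]mulr_natr.
  have -> : (#|X|%:R / #|F|%:R) ^+ 2 * #|F|%:R = #|X|%:R ^+ 2 / #|F|%:R :> R by field.
  have -> : 2 * (#|X|%:R / #|F|%:R) * #|X|%:R = 2 * (#|X|%:R ^+ 2 / #|F|%:R) :> R by field.
  have : 0 <= #|X|%:R ^+ 2 / #|F|%:R :> R by rewrite divr_ge0 // ?sqr_ge0 // ler0n.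
  by lra.
under [X in _ * X]eq_bigr do rewrite step.
have := convolution_norm_le G0 sX (zero_mean n.+1).
move: IH.
set H := \sum_s _; set H' := \sum_s _.
set q := #|F|%:R; set x := #|X|%:R; set g := #|G|%:R => IH HH'.
rewrite [leLHS](_ : _ = g ^+ n * (g * H')); last by rewrite exprS; ring.
apply: le_trans (_ : q * x * (g ^+ n * H) <= _).
  by rewrite [leRHS]mulrCA ler_wpM2l // exprn_ge0 // ler0n.
by rewrite [_ ^+ n.+1]exprS -[leRHS]mulrA ler_wpM2l // mulr_ge0 ?ler0n.
Qed.

Lemma sum_count_norm X n :
  \sum_s sum_count X n s ^+ 2 =
  \sum_s (sum_count X n s - #|X|%:R ^+ n / #|F|%:R) ^+ 2 +
  #|X|%:R ^+ n ^+ 2 / #|F|%:R.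
Proof.
have F0 : #|F|%:R != 0 :> R.
  by rewrite pnatr_eq0 -lt0n; apply/card_gt0P; exists 0.
set c := _ / _.
have E s : (sum_count X n s - c) ^+ 2 = sum_count X n s ^+ 2 - 2 * c * sum_count X n s + c ^+ 2.
  by ring.
rewrite (eq_bigr _ (fun s _ => E s)) !big_split /= sumrN -mulr_sumr sum_sum_count.
rewrite sumr_const -[_ ^+ 2 *+ _]mulr_natr /c.
by field.
Qed.

End Convolution.

(** By Cauchy-Schwarz on the support, |X|^(2n+2) is at most the size of the sumset times the sum of
    the squared counts; the latter splits into the centered part, already bounded, and the
    contribution of the mean. *)
Lemma iterated_sumset_large (F : finFieldType) (G X : {set F}) n :
  0 \notin G -> stable_under G X -> (0 < #|X|)%N ->
  (#|F| * (#|X| ^ n.+1 * #|G| ^ n) <=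
   #|iterated_sumset X n.+1| * (#|F| ^ n.+1 + #|X| ^ n.+1 * #|G| ^ n))%N.
Proof.
move=> G0 sX X0; set N := #|iterated_sumset _ _|.
have F0 : 0 < #|F|%:R :> rat by rewrite ltr0n; apply/card_gt0P; exists 0.
have X0' : 0 < #|X|%:R :> rat by rewrite ltr0n.
have := centered_sum_count_norm_le rat n G0 sX.
have := sum_count_norm rat X n.+1.
set Q := \sum_s _ ^+ 2; set H := \sum_s _ => QH HX.
have CS : (#|X|%:R ^+ n.+1) ^+ 2 <= N%:R * Q :> rat.
  rewrite -sum_sum_count.
  have supp s : s \notin iterated_sumset X n.+1 -> sum_count rat X n.+1 s = 0.
    by apply: contraNeq => /sum_count_neq0.
  have -> : \sum_s sum_count rat X n.+1 s =
      \sum_(s in iterated_sumset X n.+1) sum_count rat X n.+1 s.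
    by rewrite [RHS]big_mkcond; apply: eq_bigr => s _; case: ifPn => // /supp.
  apply: le_trans (sqr_sum_le_card _ _) _; rewrite ler_wpM2l ?ler0n //.
  rewrite [leLHS]big_mkcond; apply: ler_sum => s _; case: ifP => // _.
  by rewrite sqr_ge0.
rewrite -(@leq_pmul2r (#|X| ^ n.+1)) ?expn_gt0 ?X0 //.
rewrite -(ler_nat rat) !(natrM, natrD, natrX).
set q := #|F|%:R in F0 QH HX CS *; set x := #|X|%:R in X0' QH HX CS *.
set g := #|G|%:R in HX *; set k := N%:R in CS *.
have g0 : 0 <= g ^+ n by rewrite exprn_ge0 // ler0n.
have k0 : 0 <= k by rewrite ler0n.
apply: le_trans (_ : q * g ^+ n * (k * Q) <= _).
  rewrite [leLHS](_ : _ = q * g ^+ n * (x ^+ n.+1) ^+ 2); last by ring.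
  by rewrite ler_wpM2l // mulr_ge0 // ltW.
rewrite QH (_ : q * g ^+ n * (k * (H + x ^+ n.+1 ^+ 2 / q)) =
  k * (q * (g ^+ n * H) + (x ^+ n.+1) ^+ 2 * g ^+ n)); last first.
  by field; rewrite gt_eqF.
rewrite -[leRHS]mulrA ler_wpM2l // mulrDl lerD //; last first.
  by rewrite le_eqVlt; apply/orP; left; apply/eqP; ring.
rewrite [leRHS](_ : _ = q * ((q * x) ^+ n * x)); last first.
  by rewrite exprMn !exprS; ring.
by rewrite ler_wpM2l // ltW.
Qed.

(** * Growth of difference sets *)

Definition diffset (F : finFieldType) (X Y : {set F}) : {set F} :=
  [set x - y | x in X, y in Y].

(** With one representation d = x - y fixed for each difference, (d, z) -> (x + z, y + z) is
    injective: subtracting the components recovers d, and then z. *)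
Lemma ruzsa_triangle (F : finFieldType) (X Y Z : {set F}) :
  (#|diffset X Y| * #|Z| <= #|sumset X Z| * #|sumset Y Z|)%N.
Proof.
pose rep (d : F) := odflt (0, 0) [pick u | [&& u.1 \in X, u.2 \in Y & u.1 - u.2 == d]].
have repP d : d \in diffset X Y ->
    [/\ (rep d).1 \in X, (rep d).2 \in Y & (rep d).1 - (rep d).2 = d].
  case/imset2P => x y xX yY ->; rewrite /rep; case: pickP => [u /and3P[? ? /eqP]//|].
  by move/(_ (x, y)); rewrite /= xX yY eqxx.
pose f (v : F * F) := ((rep v.1).1 + v.2, (rep v.1).2 + v.2).
rewrite -!cardsX -(@card_in_imset _ _ f).
  apply/subset_leq_card/subsetP => w /imsetP[[d z]]; rewrite inE /= => /andP[dD zZ] ->.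
  by have [? ? _] := repP d dD; rewrite inE /= !mem_sumset.
move=> u v; move: u v => [d z] [d' z']; rewrite !inE /= => /andP[dD _] /andP[d'D _] [].
have [_ _ Ed] := repP d dD; have [_ _ Ed'] := repP d' d'D => E1 E2.
have dd : d = d'.
  rewrite -Ed -Ed'.
  transitivity ((rep d).1 + z - ((rep d).2 + z)); first by ring.
  by rewrite E1 E2; ring.
by congr (_, _) => //; apply: (addrI (rep d).1); rewrite E1 dd.
Qed.

(** * The pivot argument of Glibichuk and Konyagin *)

Section GlibichukKonyagin.
Variable F : finFieldType.
Implicit Types (G X : {set F}) (xi y : F).

Definition sumset_dilate G X xi : {set F} := [set x + xi * g | x in X, g in G].

Definition difference_quotients G X : {set F} :=
  [set xi | [exists u : F * F, exists v : F * F,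
     [&& u.1 \in X, u.2 \in X, v.1 \in G, v.2 \in G, v.1 != v.2 &
         u.1 - u.2 == xi * (v.1 - v.2)]]].

Lemma difference_quotientsP G X xi :
  reflect (exists x1 x2 g1 g2, [/\ x1 \in X, x2 \in X, g1 \in G, g2 \in G &
             g1 != g2 /\ x1 - x2 = xi * (g1 - g2)])
          (xi \in difference_quotients G X).
Proof.
rewrite inE; apply: (iffP existsP) => [[u /existsP[v]]|].
  case/and5P=> ? ? ? ? /andP[? /eqP ?].
  by exists u.1, u.2, v.1, v.2.
case=> x1 [x2] [g1] [g2] [xX1 xX2 gG1 gG2 [ne E]].
exists (x1, x2); apply/existsP; exists (g1, g2).
by rewrite /= xX1 xX2 gG1 gG2 ne E eqxx.
Qed.

Lemma sumset_dilateE G X xi :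
  sumset_dilate G X xi = [set u.1 + xi * u.2 | u in setX X G].
Proof.
apply/setP => z; apply/imset2P/imsetP => [[x g xX gG ->]|[[x g]]].
  by exists (x, g); rewrite // inE /= xX.
by rewrite inE /= => /andP[xX gG] ->; exists x g.
Qed.

(** A collision between two distinct pairs (x, g) would exhibit [xi] as a quotient of
    differences. *)
Lemma card_sumset_dilate G X xi :
  xi \notin difference_quotients G X -> #|sumset_dilate G X xi| = (#|X| * #|G|)%N.
Proof.
move=> nq; rewrite sumset_dilateE card_in_imset ?cardsX //.
move=> u v; move: u v => [x g] [x' g']; rewrite !inE /= => /andP[xX gG] /andP[x'X g'G] E.
case: (eqVneq g g') E => [-> /addIr -> //|gg' E].
case/negP: nq; apply/difference_quotientsP; exists x, x', g', g; split=> //.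
split; first by rewrite eq_sym.
rewrite (_ : x - x' = x + xi * g - x' - xi * g); last by ring.
by rewrite E; ring.
Qed.

(** Two distinct pairs (x, g) collide for at most one [xi], so with U = |X||G| there are at most
    U(|F| + U) collisions over all [xi]. Cauchy-Schwarz applies to a [xi] with at most the average
    number. *)
Lemma average_sumset_dilate G X : (0 < #|X|)%N -> (0 < #|G|)%N ->
  exists xi, (#|X| * #|G| * #|F| <= #|sumset_dilate G X xi| * (#|F| + #|X| * #|G|))%N.
Proof.
move=> X0 G0; set U := (#|X| * #|G|)%N; set S := setX X G.
have SU : #|S| = U by rewrite cardsX.
have U0 : (0 < U)%N by rewrite muln_gt0 X0.
pose E xi := (\sum_(u in S) \sum_(v in S) ((u.1 + xi * u.2)%R == (v.1 + xi * v.2)%R))%N.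
have sumE : (\sum_xi E xi <= U * (#|F| + U))%N.
  rewrite exchange_big /= -{1}SU -sum_nat_const; apply: leq_sum => u uS.
  rewrite exchange_big /=.
  apply: (@leq_trans (\sum_(v in S) ((v == u) * #|F| + 1))).
    apply: leq_sum => v _; rewrite -big_mkcond /= sum1dep_card.
    case: (eqVneq v u) => [_|vu]; first by rewrite mul1n (leq_trans (max_card _)) ?leq_addr.
    rewrite mul0n add0n; apply/card_le1_eqP => x y; rewrite !inE => /eqP Ex /eqP Ey.
    have : (x - y) * (u.2 - v.2) = 0.
      rewrite (_ : _ * _ = (u.1 + x * u.2) - (u.1 + y * u.2) - (x - y) * v.2); last by ring.
      by rewrite Ex Ey; ring.
    move/eqP; rewrite mulf_eq0 !subr_eq0 => /orP[/eqP //|/eqP uv2].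
    case/negP: vu; move: Ex; rewrite uv2 => /addIr uv1.
    by rewrite [v]surjective_pairing -uv1 -uv2 -surjective_pairing.
  rewrite big_split /= sum_nat_const muln1 -big_distrl /= addnC SU addnC leq_add2r.
  by rewrite (bigD1 u) //= eqxx big1 ?addn0 ?mul1n // => v /andP[_ /negbTE ->].
have [xi Hxi] : exists xi, (#|F| * E xi <= U * (#|F| + U))%N.
  apply/existsP; apply: contraT => /existsPn H.
  have : (\sum_(xi : F) (U * (#|F| + U)).+1 <= \sum_xi #|F| * E xi)%N.
    by apply: leq_sum => xi _; rewrite ltnNge H.
  rewrite sum_nat_const -big_distrr /= leq_pmul2l; last by apply/card_gt0P; exists 0.
  by move/leq_trans/(_ sumE); rewrite ltnn.
exists xi.
have := card_imset_collisions (fun u => u.1 + xi * u.2) S.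
rewrite -sumset_dilateE -/(E xi) SU => H.
rewrite -(leq_pmul2l U0); apply: (@leq_trans (#|sumset_dilate G X xi| * E xi * #|F|)).
  by rewrite mulnA leq_mul2r mulnn H orbT.
rewrite [leqRHS]mulnCA -mulnA leq_mul2l [(E xi * _)%N]mulnC; apply/orP; right.
by rewrite mulnC in Hxi *.
Qed.
End GlibichukKonyagin.

Lemma mem_iterated_sumset3 (F : finFieldType) (X : {set F}) x y z :
  x \in X -> y \in X -> z \in X -> x + y + z \in iterated_sumset X 3.
Proof.
move=> xX yX zX; rewrite -addrA -[z]addr0.
by do 3!apply: mem_sumset => //; rewrite set11.
Qed.

(* [X + xi G] has [|X||G|] elements unless [xi] is a quotient of differences
   [(x1 - x2) / (g1 - g2)].  If some quotient [xi] is such that [xi + y] is not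
   one, then [(g1 - g2) (X + (xi + y) G)] has [|X||G|] elements and lies in
   [3X - 3X]; otherwise every element of the field is a quotient, [y] being an additive
   generator, and one may use the best [xi]. *)
Lemma triple_difference_set_large p (G X : {set 'F_p}) y :
  prime p -> stable_under G G -> stable_under G X -> (1 < #|G|)%N ->
  y \in X -> y != 0 ->
  (#|X| * #|G| * p <=
   #|diffset (iterated_sumset X 3) (iterated_sumset X 3)| * (p + #|X| * #|G|))%N.
Proof.
move=> p_pr sG sX G1 yX y0; set W := diffset _ _.
have X0 : (0 < #|X|)%N by apply/card_gt0P; exists y.
have G0 : (0 < #|G|)%N by rewrite ltnW.
set R := difference_quotients G X.
have embed xi g1 g2 : g1 != g2 ->
    (forall x g, x \in X -> g \in G -> (g1 - g2) * (x + xi * g) \in W) ->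
    (#|sumset_dilate G X xi| <= #|W|)%N.
  move=> ne H; rewrite -(card_imset _ (mulfI (_ : g1 - g2 != 0))) ?subr_eq0 //.
  apply/subset_leq_card/subsetP => w /imsetP[v /imset2P[x g xX gG ->] ->].
  exact: H.
have inW a b c a' b' c' : a \in X -> b \in X -> c \in X ->
    a' \in X -> b' \in X -> c' \in X -> a + b + c - (a' + b' + c') \in W.
  by move=> *; apply: imset2_f; apply: mem_iterated_sumset3.
have small xi : xi \in R -> (#|sumset_dilate G X xi| <= #|W|)%N.
  case/difference_quotientsP=> x1 [x2] [g1] [g2] [xX1 xX2 gG1 gG2 [ne E]].
  apply: (embed _ _ _ ne) => x g xX gG.
  (* [y] only pads both sides to three summands. *)
  rewrite (_ : _ * _ = g1 * x + g * x1 + y - (g2 * x + g * x2 + y)).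
    by apply: inW; rewrite ?sX.
  rewrite (_ : _ * _ = (g1 - g2) * x + xi * (g1 - g2) * g); last by ring.
  by rewrite -E; ring.
case: (boolP [exists xi, (xi \in R) && (xi + y \notin R)]).
  case/existsP=> xi /andP[/difference_quotientsP xiR nR].
  apply: (@leq_trans (#|X| * #|G| * (p + #|X| * #|G|))).
    by rewrite leq_mul2l leq_addr orbT.
  rewrite leq_mul2r -(card_sumset_dilate nR); apply/orP; right.
  case: xiR => x1 [x2] [g1] [g2] [xX1 xX2 gG1 gG2 [ne E]].
  apply: (embed _ _ _ ne) => x g xX gG.
  rewrite (_ : _ * _ = g1 * x + g * x1 + (g * g1) * y - (g2 * x + g * x2 + (g * g2) * y)).
    by apply: inW; rewrite ?sX ?sG.
  rewrite (_ : _ * _ = (g1 - g2) * x + xi * (g1 - g2) * g + y * (g1 - g2) * g); last by ring.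
  by rewrite -E; ring.
move/existsPn=> step.
(* The quotients contain 0 and are stable under adding [y]; in a prime field every element is an
   integer multiple of [y]. *)
have Rfull xi : xi \in R.
  have R0 : 0 \in R.
    have [g1 [g2 [gG1 gG2 ne]]] := card_gt1P G1.
    apply/difference_quotientsP; exists y, y, g1, g2; split=> //.
    by rewrite subrr mul0r.
  have Rn n : y *+ n \in R.
    elim: n => [|n IH]; first by rewrite mulr0n.
    by have := step (y *+ n); rewrite IH /= negbK mulrSr.
  rewrite (_ : xi = y *+ (xi / y)%R); first exact: Rn.
  by rewrite -mulr_natl natr_Zp mulfVK.
have [xi] := average_sumset_dilate X0 G0; rewrite card_Fp // => H.
by apply: leq_trans H _; rewrite leq_mul2r small ?orbT.
Qed.

(** * Squared differences of a multiplicative subgroup *)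

Section MultiplicativeSubsets.
Variable F : finFieldType.
Implicit Types (A G X : {set F}).

(** Multiplication by [g] permutes [G], so the nonzero product of all elements of [G] is unchanged
    when multiplied by g^|G|. *)
Lemma stable_expr_card G g :
  0 \notin G -> stable_under G G -> g \in G -> g ^+ #|G| = 1.
Proof.
move=> G0 sG gG; have P0 : \prod_(x in G) x != 0.
  by apply/prodf_neq0 => x xG; apply: contraNneq G0 => <-.
have g0 : g != 0 by apply: contraNneq G0 => <-.
apply: (mulIf P0); rewrite mul1r -[in RHS](dilate_stable G0 sG gG).
rewrite big_imset /=; last by move=> ? ? _ _; apply: mulfI.
by rewrite big_split /= prodr_const.
Qed.

Lemma card_squares X : (#|X| <= 2 * #|[set x ^+ 2 | x in X]|)%N.
Proof.
rewrite -[leqLHS](sum1_card (mem X)) (partition_big_imset (fun x => x ^+ 2)) /= mulnC.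
rewrite -sum_nat_const; apply: leq_sum => u /imsetP[x xX ->]; rewrite sum1dep_card.
apply: leq_trans (_ : #|[set x; - x]| <= 2)%N; last by rewrite cards2; case: (_ == _).
by apply/subset_leq_card/subsetP => y; rewrite !inE eqf_sqr => /andP[].
Qed.

Definition square_set A : {set F} := [set a ^+ 2 | a in A].

Definition squared_differences A : {set F} := [set (a - b) ^+ 2 | a in A, b in A].

Lemma iterated_sumset_cat X m n x y :
  x \in iterated_sumset X m -> y \in iterated_sumset X n ->
  x + y \in iterated_sumset X (m + n).
Proof.
elim: m x => [|m IH] x; first by move=> /set1P ->; rewrite add0r.
by case/imset2P => z x' zX x'X -> yX; rewrite -addrA mem_sumset // IH.
Qed.

Lemma iterated_sumset_mul X m n :
  iterated_sumset (iterated_sumset X m) n \subset iterated_sumset X (m * n).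
Proof.
apply/subsetP => x; elim: n x => [|n IH] x; first by rewrite muln0.
case/imset2P => y z yX zX ->; rewrite mulnS.
by apply: iterated_sumset_cat => //; apply: IH.
Qed.

Lemma iterated_sumset_mono X m n : 0 \in X -> (m <= n)%N ->
  iterated_sumset X m \subset iterated_sumset X n.
Proof.
move=> X0 /subnK <-; elim: (_ - _)%N => [//|k IH]; apply: subset_trans IH _.
by apply/subsetP => x xX; rewrite -[x]add0r mem_sumset.
Qed.

Lemma iterated_sumset_distance_set A d :
  iterated_sumset (squared_differences A) d \subset distance_set (cart_power d A).
Proof.
apply/subsetP => s sD.
have [f [g [fA gA ->]]] : exists f g : nat -> F,
    [/\ forall i, (i < d)%N -> f i \in A, forall i, (i < d)%N -> g i \in A &
        s = \sum_(i < d) (f i - g i) ^+ 2].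
  elim: d s sD => [|d IH] s.
    by move=> /set1P ->; exists (fun=> 0), (fun=> 0); rewrite big_ord0.
  case/imset2P => _ s' /imset2P[a b aA bA ->] /IH[f [g [fA gA ->]]] ->.
  exists (fun i => if i is j.+1 then f j else a), (fun i => if i is j.+1 then g j else b).
  by split=> [[|i] //|[|i] //|]; [exact: fA|exact: gA|rewrite big_ord_recl].
apply/imset2P; exists (\row_(i < d) f i) (\row_(i < d) g i).
- by rewrite inE; apply/forallP => i; rewrite mxE fA.
- by rewrite inE; apply/forallP => i; rewrite mxE gA.
- by apply: eq_bigr => i _; rewrite !mxE.
Qed.

Section Group.
Variable A : {set F}.
Hypotheses (A1 : 1 \in A) (A0 : 0 \notin A) (sA : stable_under A A).
Local Notation G := (square_set A).
Local Notation D := (squared_differences A).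

Lemma square_set1 : 1 \in G.
Proof. by apply/imsetP; exists 1; rewrite ?expr1n. Qed.

Lemma square_set0 : 0 \notin G.
Proof.
apply/imsetP => -[a aA /esym/eqP]; rewrite expf_eq0 /= => /eqP a0.
by case/negP: A0; rewrite -a0.
Qed.

Lemma stable_square_set : stable_under G G.
Proof.
move=> g h /imsetP[a aA ->] /imsetP[b bA ->].
by rewrite -exprMn; apply/imset_f/sA.
Qed.

Lemma stable_squared_differences : stable_under G D.
Proof.
move=> g h /imsetP[a aA ->] /imset2P[b c bA cA ->].
by rewrite -exprMn mulrBr; apply: imset2_f; apply: sA.
Qed.

Lemma squared_differences0 : 0 \in D.
Proof. by apply/imset2P; exists 1 1; rewrite ?subrr ?expr0n. Qed.

Lemma squared_differences_neq0 : (1 < #|A|)%N -> exists2 y, y \in D & y != 0.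
Proof.
case/card_gt1P => a [b [aA bA ab]]; exists ((a - b) ^+ 2); first exact: imset2_f.
by rewrite expf_neq0 // subr_eq0.
Qed.

Lemma card_square_set_le : (#|G| <= #|A|)%N.
Proof. exact: leq_imset_card. Qed.

Lemma card_square_set_ge : (#|A| <= 2 * #|G|)%N.
Proof. exact: card_squares. Qed.

Lemma card_square_set_le_differences : (1 < #|A|)%N -> (#|G| <= #|D|)%N.
Proof.
case/squared_differences_neq0 => y yD y0.
rewrite -(card_imset _ (mulIf y0)); apply/subset_leq_card/subsetP => _ /imsetP[g gG ->].
exact: stable_squared_differences.
Qed.
End Group.
End MultiplicativeSubsets.

Lemma pow2_mul_exp e x k : (2 ^ e * (2 * x) ^ k = 2 ^ (e + k) * x ^ k)%N.
Proof. by rewrite expnMn mulnA expnD. Qed.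

Lemma pow2_mul_sqr e f x :
  (2 ^ e * (2 ^ f * x ^ 2) ^ 2 = 2 ^ (e + f * 2) * x ^ 4)%N.
Proof. by rewrite expnMn -!expnM mulnA -expnD. Qed.

(** * Lower bounds for [D] and its sumsets over a prime field *)

Section PrimeField.
Variables (q : nat) (A : {set 'F_q}).
Hypotheses (q_pr : prime q) (A1 : 1 \in A) (A0 : 0 \notin A).
Hypotheses (sA : stable_under A A) (Agt1 : (1 < #|A|)%N).
Local Notation G := (square_set A).
Local Notation D := (squared_differences A).
Local Notation n := #|A|.

(** The Stepanov bound is used with X = -A, where X + A = A - A; squaring loses at most a factor 2,
    which turns 2^18 into 2^20. *)
Lemma squared_differences_ge : (n ^ 3 <= q ^ 2 -> n ^ 3 <= 2 ^ 20 * #|D| ^ 2)%N.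
Proof.
move=> nq; pose X := [set - a | a in A].
have sX : stable_under A X.
  by move=> a _ aA /imsetP[b bA ->]; rewrite -mulrN1 mulrA mulrN1; apply/imset_f/sA.
have X0 : 0 \notin X.
  by apply/imsetP => -[b bA /esym/eqP]; rewrite oppr_eq0 => /eqP b0; case/negP: A0; rewrite -b0.
have Xn : #|X| = n by rewrite card_imset //; apply: oppr_inj.
have SD : (#|sumset X A| <= 2 * #|D|)%N.
  apply: leq_trans (card_squares _) _; rewrite leq_mul2l /=.
  apply/subset_leq_card/subsetP => _ /imsetP[_ /imset2P[_ b /imsetP[a aA ->] bA ->] ->].
  by rewrite addrC; apply: imset2_f.
(* If this failed, the sumset would be small enough for the size hypotheses of
   [sumset_subgroup_bound], whose conclusion is this very inequality. *)
have key : (n ^ 3 <= 2 ^ 18 * #|sumset X A| ^ 2)%N.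
  rewrite leqNgt; apply/negP => lt.
  have s0 : (0 < #|sumset X A|)%N.
    apply/card_gt0P; exists (- 1 + 1); apply: mem_sumset => //; exact: imset_f.
  have := @sumset_subgroup_bound q A X q_pr A1 A0 sA
    (fun a aA => stable_expr_card A0 sA aA) sX X0.
  rewrite Xn; move: lt s0; set s := #|sumset X A| => lt s0.
  have n4 : (4 <= n)%N.
    rewrite leqNgt; apply/negP => n4.
    have h : (n ^ 3 <= 3 ^ 3)%N by rewrite leq_exp2r.
    by move: (leq_trans lt h); nia.
  move/(_ n4) => H.
  have h1 : (8 * (n * s) < n ^ 4)%N.
    rewrite mulnCA expnS ltn_pmul2l; last by apply: leq_trans n4.
    apply: leq_ltn_trans lt; nia.
  have h2 : (64 * (n * s) * n ^ 2 <= q ^ 3)%N.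
    rewrite -(@leq_exp2r _ _ 2) //; apply: (@leq_trans (n ^ 9)).
      rewrite (_ : (64 * (n * s) * n ^ 2) ^ 2 = n ^ 6 * (2 ^ 12 * s ^ 2))%N; last by ring.
      rewrite (expnD n 6 3) leq_mul2l; apply/orP; right.
      by apply: leq_trans (ltnW lt); nia.
    by rewrite -expnM (expnM q 2 3) (expnM n 3 3) leq_exp2r.
  by have := H h1 h2; rewrite -expnSr leqNgt lt.
apply: leq_trans key _; apply: (@leq_trans (2 ^ 18 * (2 * #|D|) ^ 2)).
  by rewrite leq_mul2l leq_exp2r // SD orbT.
exact: (eq_leq (pow2_mul_exp 18 _ 2)).
Qed.

(** The Stepanov bound for [G] and a dilate of the nonzero part of [D] gives |D + D|^2 >> n^2 |D|;
    then |D| >> n^(3/2) is inserted. *)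
Lemma double_squared_differences_ge :
  (n ^ 2 <= q -> n ^ 7 <= 2 ^ 62 * #|iterated_sumset D 2| ^ 4)%N.
Proof.
move=> nq; have [y yD y0] := squared_differences_neq0 Agt1.
have sD := stable_squared_differences sA.
have nq3 : (n ^ 3 <= q ^ 2)%N.
  apply: leq_trans (_ : (n ^ 2) ^ 2 <= _)%N; last by rewrite leq_exp2r.
  by rewrite -expnM leq_pexp2l // ltnW.
have nD := squared_differences_ge nq3.
have D0 := squared_differences0 A1.
have DS : (#|D| <= #|iterated_sumset D 2|)%N.
  have := subset_leq_card (iterated_sumset_mono D0 (isT : (1 <= 2)%N)).
  suff -> : iterated_sumset D 1 = D by [].
  apply/setP => x; apply/imset2P/idP => [[u v uD /set1P -> ->]|xD].
    by rewrite addr0.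
  by exists x 0; rewrite ?addr0 // set11.
(* As y(x / y + g) = x + gy with gy in [D], a dilate of X + G lies in D + D. *)
pose X := [set x / y | x in D :\ 0].
have sX : stable_under G X.
  move=> g _ gG /imsetP[x /setD1P[x0 xD] ->]; rewrite mulrA; apply: imset_f.
  rewrite !inE sD // andbT mulf_neq0 //.
  by apply: contraNneq (square_set0 A0) => <-.
have X0 : 0 \notin X.
  apply/imsetP => -[x /setD1P[x0 xD] /esym/eqP].
  by rewrite mulf_eq0 invr_eq0 (negbTE x0) (negbTE y0).
have cX : #|D| = #|X|.+1.
  by rewrite card_imset ?(cardsD1 0 D) ?D0 //; apply: mulIf; rewrite invr_eq0.
have sS : (#|sumset X G| <= #|iterated_sumset D 2|)%N.
  rewrite -(card_imset _ (mulfI y0)); apply/subset_leq_card/subsetP.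
  move=> _ /imsetP[_ /imset2P[_ g /imsetP[x /setD1P[_ xD] ->] gG ->] ->].
  rewrite mulrDr mulrC mulfVK // [y * g]mulrC -[g * y]addr0.
  by do 2!apply: mem_sumset => //; rewrite ?set11 // sD.
have tn := card_square_set_le A; have nt := card_square_set_ge A.
have := sumset_subgroup_bound q_pr (square_set1 A1) (square_set0 A0)
  (stable_square_set sA)
  (fun g gG => stable_expr_card (square_set0 A0) (stable_square_set sA) gG) sX X0.
move: nD DS cX sS tn nt; set s := #|sumset X G|; set S := #|iterated_sumset D 2|.
set t := #|G|; set x := #|X|; set delta := #|D| => nD DS cX sS tn nt main.
have S0 : (0 < S)%N by rewrite (leq_trans _ DS) // cX.
have xS : (x <= S)%N by apply: leq_trans DS; rewrite cX.
rewrite leqNgt; apply/negP => lt.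
(* If |X| <= 3 then |D| <= 4, so n^3 <= 2^24 and n^7 <= 2^56, against [lt]. *)
have x4 : (4 <= x)%N.
  rewrite leqNgt; apply/negP => x4.
  have n28 : (n <= 2 ^ 8)%N.
    rewrite -(@leq_exp2r _ _ 3) //; apply: leq_trans nD _.
    by move: (delta) cX => d cX; nia.
  have h : (n ^ 7 <= (2 ^ 8) ^ 7)%N by rewrite leq_exp2r.
  have h' := leq_trans lt h; rewrite -expnM in h'.
  have := leq_trans (leq_pmulr (2 ^ 62) (_ : 0 < S ^ 4)%N) (ltnW h').
  by rewrite expn_gt0 S0 => /(_ isT); rewrite leq_exp2l.
have XS2 : ((x * s) ^ 2 <= S ^ 4)%N.
  by rewrite expnMn (expnD S 2 2) leq_mul // leq_exp2r.
have n8 : (n ^ 8 <= 2 ^ 8 * t ^ 8)%N by rewrite -expnMn leq_exp2r.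
have n78 : (n ^ 7 <= n ^ 8)%N by rewrite leq_pexp2l // ltnW.
have c1 : (8 * (x * s) < t ^ 4)%N.
  rewrite -(@ltn_exp2r _ _ 2) // expnMn -expnM.
  move: XS2 lt n8 n78; move: ((x * s) ^ 2)%N (S ^ 4)%N (n ^ 7)%N (n ^ 8)%N => a b c d.
  by rewrite (_ : 4 * 2 = 8)%N //; move: (t ^ 8)%N => e; lia.
have c2 : (64 * (x * s) * t ^ 2 <= q ^ 3)%N.
  rewrite -(@leq_exp2r _ _ 2) //; apply: (@leq_trans ((n ^ 2) ^ 6)); last first.
    by rewrite -(expnM q 3 2) leq_exp2r.
  rewrite 2!expnMn -!expnM (expnD n 8 4).
  apply: leq_mul; last by rewrite leq_exp2r.
  move: XS2 lt n78; rewrite expnMn.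
  move: (S ^ 4)%N (n ^ 7)%N (n ^ 8)%N (x ^ 2 * s ^ 2)%N => a b c d.
  by lia.
have main' := main x4 c1 c2.
have H1 : (n ^ 2 * delta <= 2 ^ 21 * S ^ 2)%N.
  apply: (@leq_trans ((2 * t) ^ 2 * (2 * x))).
    by rewrite leq_mul ?leq_exp2r // cX; lia.
  rewrite (_ : (2 * t) ^ 2 * (2 * x) = 2 ^ 3 * (t ^ 2 * x))%N; last by ring.
  rewrite (expnD 2 3 18) -mulnA leq_mul2l /=; apply: leq_trans main' _.
  by rewrite leq_mul2l leq_exp2r // sS orbT.
move: lt; rewrite ltnNge => /negP; apply.
rewrite (expnD n 4 3); apply: (@leq_trans (n ^ 4 * (2 ^ 20 * delta ^ 2))).
  by rewrite leq_mul2l nD orbT.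
rewrite mulnCA (expnM n 2 2) -expnMn.
apply: leq_trans (eq_leq (pow2_mul_sqr 20 21 S)).
by rewrite leq_mul2l leq_exp2r // H1 orbT.
Qed.

End PrimeField.

Lemma pow2_mul_mul_exp e k x y :
  (2 ^ e * x ^ k * (2 * y) ^ k = 2 ^ (e + k) * (x * y) ^ k)%N.
Proof. by rewrite [((2 * y) ^ k)%N]expnMn mulnACA -expnD -expnMn. Qed.

Lemma pow2_sqr_mul_exp e f x y :
  ((2 ^ e * x ^ 2) ^ 2 * (2 ^ f * y ^ 4) = 2 ^ (e * 2 + f) * (x * y) ^ 4)%N.
Proof. by rewrite [((2 ^ e * x ^ 2) ^ 2)%N]expnMn -!expnM mulnACA -expnD -expnMn. Qed.

Section SixFold.
Variables (q : nat) (A : {set 'F_q}).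
Hypotheses (q_pr : prime q) (A1 : 1 \in A) (A0 : 0 \notin A).
Hypotheses (sA : stable_under A A) (Agt1 : (1 < #|A|)%N).
Local Notation G := (square_set A).
Local Notation D := (squared_differences A).
Local Notation n := #|A|.

(** With W = |3D - 3D|, the pivot argument gives W >> min(|D||G|, q) >> min(n^(5/2), q), and Ruzsa's
    inequality gives |6D|^2 >= W|3D| >= W|2D| >> W n^(7/4). The eighth power clears the fractional
    exponents. *)
Lemma sextuple_squared_differences_ge : (n ^ 2 <= q ->
  minn (n ^ 5) (q ^ 2) ^ 2 * n ^ 7 <= 2 ^ 110 * #|iterated_sumset D 6| ^ 8)%N.
Proof.
move=> nq; have [y yD y0] := squared_differences_neq0 Agt1.
have sD := stable_squared_differences sA.
have nq3 : (n ^ 3 <= q ^ 2)%N.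
  apply: leq_trans (_ : (n ^ 2) ^ 2 <= _)%N; last by rewrite leq_exp2r.
  by rewrite -expnM leq_pexp2l // ltnW.
have nD := squared_differences_ge q_pr A1 A0 sA Agt1 nq3.
have nS := double_squared_differences_ge q_pr A1 A0 sA Agt1 nq.
have D0 := squared_differences0 A1.
have nt := card_square_set_ge A.
set m := minn _ _; set S6 := #|iterated_sumset D 6|.
have m5 : (m <= n ^ 5)%N := geq_minl _ _; have mq : (m <= q ^ 2)%N := geq_minr _ _.
have S60 : (0 < S6)%N.
  by apply/card_gt0P; exists 0; apply: (subsetP (iterated_sumset_mono D0 (leq0n 6))); apply: set11.
(* The pivot needs two elements of [G]; otherwise n <= 2 and the constant absorbs the left-hand
   side. *)
have [t1|t1] := leqP #|G| 1.
  have n2 : (n <= 2)%N by apply: leq_trans nt _; rewrite -[leqRHS]muln1 leq_mul2l.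
  apply: (@leq_trans (2 ^ 17)).
    apply: (@leq_trans ((2 ^ 5) ^ 2 * 2 ^ 7)); last by rewrite -expnM -expnD.
    by apply: leq_mul; rewrite leq_exp2r // (leq_trans m5) // leq_exp2r.
  apply: (@leq_trans (2 ^ 110)); first by rewrite leq_exp2l.
  by rewrite leq_pmulr // expn_gt0 S60.
have tri := triple_difference_set_large q_pr (stable_square_set sA) sD t1 yD y0.
have ruz := ruzsa_triangle (iterated_sumset D 3) (iterated_sumset D 3) (iterated_sumset D 3).
have T6 : (#|sumset (iterated_sumset D 3) (iterated_sumset D 3)| <= S6)%N.
  apply/subset_leq_card/subsetP => _ /imset2P[u v uT vT ->].
  exact: (iterated_sumset_cat uT vT).
have ST := subset_leq_card (iterated_sumset_mono D0 (isT : (2 <= 3)%N)).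
have D_gt0 : (0 < #|D|)%N by apply/card_gt0P; exists 0.
move: tri ruz T6 ST nS nD; set W := #|diffset _ _|; set T := #|iterated_sumset D 3|.
set S := #|iterated_sumset D 2|; set TT := #|sumset _ _|; set U := (#|D| * #|G|)%N.
move=> tri ruz T6 ST nS nD.
have U0 : (0 < U)%N by rewrite muln_gt0 D_gt0 ltnW.
have WS : (W * S <= S6 ^ 2)%N.
  apply: leq_trans (_ : TT * TT <= _)%N; last by rewrite -mulnn leq_mul.
  by apply: leq_trans ruz; rewrite leq_mul2l ST orbT.
have nU : (n ^ 5 <= 2 ^ 22 * U ^ 2)%N.
  rewrite (expnD n 3 2); apply: leq_trans (leq_mul nD (_ : n ^ 2 <= (2 * #|G|) ^ 2)%N) _.
    by rewrite leq_exp2r.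
  exact: (eq_leq (pow2_mul_mul_exp 20 2 _ _)).
have mW : (m <= 2 ^ 24 * W ^ 2)%N.
  have [Uq|qU] := leqP U q.
    have UW : (U <= 2 * W)%N.
      rewrite -(leq_pmul2r (prime_gt0 q_pr)); apply: leq_trans tri _; nia.
    apply: leq_trans m5 _; apply: leq_trans nU _.
    apply: leq_trans (eq_leq (pow2_mul_exp 22 W 2)).
    by rewrite leq_mul2l leq_exp2r // UW orbT.
  have qW : (q <= 2 * W)%N.
    rewrite -(leq_pmul2l U0); apply: leq_trans tri _; nia.
  apply: leq_trans mq _; apply: leq_trans (_ : (2 * W) ^ 2 <= _)%N; first by rewrite leq_exp2r.
  apply: leq_trans (eq_leq (expnMn 2 W 2)) _.
  exact: (leq_mul (leq_pexp2l (isT : 0 < 2)%N (isT : 2 <= 24)%N) (leqnn (W ^ 2)%N)).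
apply: (@leq_trans (2 ^ 110 * (W * S) ^ 4)); last first.
  by rewrite leq_mul2l (expnM S6 2 4) leq_exp2r // WS orbT.
apply: leq_trans (leq_mul (_ : m ^ 2 <= (2 ^ 24 * W ^ 2) ^ 2)%N nS) _.
  by rewrite leq_exp2r.
exact: (eq_leq (pow2_sqr_mul_exp 24 62 W S)).
Qed.
End SixFold.

(** Fraction-free comparison of the exponents e/c <= b/a. *)
Lemma leq_exp_ratio q n a b c e : (0 < a)%N -> (0 < q)%N ->
  (q ^ b <= n ^ a)%N -> (e * a <= c * b)%N -> (q ^ e <= n ^ c)%N.
Proof.
move=> a0 q0 qn ec; rewrite -(leq_exp2r _ _ a0) -!expnM.
apply: leq_trans (leq_pexp2l q0 ec) _.
rewrite ![(c * _)%N]mulnC !expnM; case: (posnP c) => [->//|c0].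
by rewrite leq_exp2r.
Qed.

Lemma iterated_sumset_positive_proportion (F : finFieldType) (G X : {set F}) j K :
  0 \notin G -> stable_under G X -> (0 < #|X|)%N -> (0 < #|G|)%N ->
  (#|F| ^ j.+1 <= K * (#|X| ^ j.+1 * #|G| ^ j))%N ->
  (#|F| <= (K + 1) * #|iterated_sumset X j.+1|)%N.
Proof.
move=> G0 sX X0 Gp qV; have := @iterated_sumset_large F G X j G0 sX X0.
set V := (#|X| ^ j.+1 * #|G| ^ j)%N in qV *.
have V0 : (0 < V)%N by rewrite muln_gt0 !expn_gt0 X0 Gp.
move=> H; rewrite -(leq_pmul2r V0); apply: leq_trans H _.
by rewrite mulnAC mulnC leq_mul2r mulnDl mul1n leq_add2r qV orbT.
Qed.

(** * Case distinction on the size of the subgroup *)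

Section Cases.
Variables (d q : nat) (A : {set 'F_q}).
Hypotheses (q_pr : prime q) (A1 : 1 \in A) (A0 : 0 \notin A).
Hypotheses (sA : stable_under A A) (Agt1 : (1 < #|A|)%N).
Local Notation G := (square_set A).
Local Notation D := (squared_differences A).
Local Notation n := #|A|.
Local Notation t := #|square_set A|.

Let G_gt0 : (0 < t)%N.
Proof. by apply/card_gt0P; exists 1; apply: square_set1. Qed.

Let D_gt0 : (0 < #|D|)%N.
Proof. by apply/card_gt0P; exists 0; apply: squared_differences0. Qed.

Lemma distances_of_differences K j : d = j.+1 ->
  (q ^ d <= K * (#|D| ^ d * t ^ j))%N -> (q <= (K + 1) * #|iterated_sumset D d|)%N.
Proof.
move=> -> H; rewrite -{1}(card_Fp q_pr).
apply: (iterated_sumset_positive_proportion (square_set0 A0)) => //.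
  exact: stable_squared_differences.
by rewrite card_Fp.
Qed.

(** Here |D| >= t >= n/2 gives |D|^d t^(d-1) >> n^(2d-1), and q^2 <= n^3 suffices because 3d <= 2(2d
    - 1) for d >= 2. *)
Lemma large_subgroup_case : (1 < d)%N -> (q ^ 2 <= n ^ 3)%N ->
  (q <= (2 ^ (15 * d) + 1) * #|iterated_sumset D d|)%N.
Proof.
case Ed: d => [//|j] j0 qn; rewrite -Ed; apply: (distances_of_differences Ed).
have h : (q ^ d <= n ^ (2 * d).-1)%N.
  by apply: leq_exp_ratio qn _; [|exact: prime_gt0|lia].
apply: leq_trans h _; rewrite Ed (_ : (2 * j.+1).-1 = j.+1 + j)%N; last by lia.
rewrite expnD; apply: (@leq_trans ((2 * #|D|) ^ j.+1 * (2 * t) ^ j)).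
  apply: leq_mul; last first.
    by case: (j) => [|i]; rewrite ?expn0 // leq_exp2r // card_square_set_ge.
  rewrite leq_exp2r //; apply: leq_trans (card_square_set_ge A) _.
  by rewrite leq_mul2l card_square_set_le_differences.
rewrite !expnMn mulnACA -expnD leq_mul2r leq_exp2l //; apply/orP; right; lia.
Qed.

(** The squared criterion involves |D|^(2d) t^(2d-2) >> n^(3d) n^(2d-2), hence the exponent 5d -
    2. *)
Lemma medium_subgroup_case : (1 < d)%N -> (n ^ 3 <= q ^ 2)%N ->
  (q ^ (2 * d) <= n ^ (5 * d - 2))%N ->
  (q <= (2 ^ (15 * d) + 1) * #|iterated_sumset D d|)%N.
Proof.
case Ed: d => [//|j] j0 nq h; rewrite -Ed; apply: (distances_of_differences Ed).
have nD := squared_differences_ge q_pr A1 A0 sA Agt1 nq.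
have nt := card_square_set_ge A.
rewrite -(@leq_exp2r _ _ 2) // -expnM mulnC Ed; apply: leq_trans h _.
rewrite (_ : 5 * j.+1 - 2 = 3 * j.+1 + 2 * j)%N; last by lia.
rewrite expnD 2!expnM.
apply: leq_trans (leq_mul (_ : _ <= (2 ^ 20 * #|D| ^ 2) ^ j.+1)%N (_ : _ <= ((2 * t) ^ 2) ^ j)%N) _.
- by rewrite leq_exp2r.
- by rewrite leq_exp2r // leq_exp2r.
rewrite [((2 ^ 20 * _) ^ _)%N]expnMn -[(((2 * t) ^ 2) ^ j)%N]expnM [((2 * t) ^ _)%N]expnMn.
rewrite [((2 ^ _ * (_ * _)) ^ 2)%N]expnMn [((_ * t ^ j) ^ 2)%N]expnMn -!expnM mulnACA -expnD.
rewrite [(j.+1 * 2)%N]mulnC [(j * 2)%N]mulnC leq_mul2r leq_exp2l //; apply/orP; right; lia.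
Qed.

(** The criterion for j-fold sums of 6D, raised to the eighth power; as 0 is in [D] and 6j <= d,
    these sums lie in the d-fold sumset. *)
Lemma small_subgroup_case j : (0 < j)%N -> (6 * j <= d)%N -> (n ^ 2 <= q)%N ->
  (q ^ (8 * j) <= (minn (n ^ 5) (q ^ 2) ^ 2 * n ^ 7) ^ j * n ^ (8 * j.-1))%N ->
  (q <= (2 ^ (15 * d) + 1) * #|iterated_sumset D d|)%N.
Proof.
case: j => // j _ jd nq h.
have D0 := squared_differences0 A1.
have nS := sextuple_squared_differences_ge q_pr A1 A0 sA Agt1 nq.
have nt := card_square_set_ge A.
set X := iterated_sumset D 6.
have sX : stable_under G X.
  exact: stable_iterated_sumset (stable_squared_differences sA).
have X_gt0 : (0 < #|X|)%N.
  by apply/card_gt0P; exists 0; apply: (subsetP (iterated_sumset_mono D0 (leq0n 6))); apply: set11.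
have sub : (#|iterated_sumset X j.+1| <= #|iterated_sumset D d|)%N.
  apply/subset_leq_card/(subset_trans (iterated_sumset_mul _ _ _)).
  exact: iterated_sumset_mono.
suff H : (q ^ j.+1 <= 2 ^ (15 * d) * (#|X| ^ j.+1 * t ^ j))%N.
  rewrite -{1}(card_Fp q_pr); apply: leq_trans (leq_mul (leqnn _) sub).
  apply: (iterated_sumset_positive_proportion (square_set0 A0)) => //.
  by rewrite card_Fp.
rewrite -(@leq_exp2r _ _ 8) // -expnM mulnC; apply: leq_trans h _ => /=.
apply: leq_trans (leq_mul (_ : _ <= (2 ^ 110 * #|X| ^ 8) ^ j.+1)%N
  (_ : _ <= (2 * t) ^ (8 * j))%N) _.
- by rewrite leq_exp2r.
- by case: (8 * j)%N => // k; rewrite leq_exp2r.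
rewrite [((2 ^ 110 * _) ^ _)%N]expnMn [((2 * t) ^ _)%N]expnMn -!expnM mulnACA -expnD.
rewrite [((2 ^ (15 * d) * _) ^ 8)%N]expnMn [((#|X| ^ j.+1 * _) ^ 8)%N]expnMn -!expnM.
rewrite [(j.+1 * 8)%N]mulnC [(j * 8)%N]mulnC leq_mul2r leq_exp2l //; apply/orP; right; lia.
Qed.

Lemma distances_ge : (1 < d)%N -> (q ^ (9 * d + 36) <= n ^ (28 * d))%N ->
  (q <= (2 ^ (15 * d) + 1) * #|iterated_sumset D d|)%N.
Proof.
move=> d1 h; have d0 : (0 < d)%N by rewrite ltnW.
have q0 := prime_gt0 q_pr.
have [|n3q] := leqP (q ^ 2) (n ^ 3); first exact: large_subgroup_case.
have [qn2|n2q] := leqP q (n ^ 2).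
  apply: (medium_subgroup_case d1 (ltnW n3q)).
  by apply: (leq_exp_ratio (a := 2) (b := 1)); rewrite ?expn1 //; lia.
(* The comparison 56d^2 <= (5d - 2)(9d + 36) reads 11d^2 - 162d + 72 <= 0, which holds for 1 <= d <=
   14 and fails at d = 15. *)
have [d14|d15] := leqP d 14.
  apply: (medium_subgroup_case d1 (ltnW n3q)).
  by apply: leq_exp_ratio h _ => //; nia.
pose j := (d %/ 6)%N.
have j2 : (2 <= j)%N by rewrite /j; lia.
have jd : (6 * j <= d <= 6 * j + 5)%N by rewrite /j; lia.
case/andP: jd => jd dj.
apply: (small_subgroup_case (ltnW j2) jd (ltnW n2q)).
(* If n^5 <= q^2 the right-hand side is n^(25j-8), and 224jd <= (25j - 8)(9d + 36) follows from d <=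
   6j + 5 and j >= 2. Otherwise it is q^(4j) n^(15j-8), and 20j <= 2(15j - 8) again by j >= 2. *)
have [n5q|q2n] := leqP (n ^ 5) (q ^ 2).
  rewrite -!expnM -expnD -!expnM -expnD.
  by apply: leq_exp_ratio h _ => //; nia.
rewrite -expnM expnMn -!expnM.
rewrite -mulnA -expnD (_ : 8 * j = 4 * j + 4 * j)%N; last by lia.
rewrite expnD leq_mul //; apply: leq_exp_ratio (ltnW q2n) _ => //; nia.
Qed.
End Cases.

(** * From groups of units to subsets of the field, and conclusion *)

Section UnitsImage.
Variables (F : finFieldType) (A : {group {unit F}}).

Lemma card_units_image : #|units_image A| = #|A|.
Proof. by rewrite card_imset //; apply: val_inj. Qed.

Lemma units_image1 : 1 \in units_image A.
Proof. by apply/imsetP; exists 1%g; rewrite ?group1. Qed.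

Lemma units_image0 : 0 \notin units_image A.
Proof.
apply/imsetP => -[u _ u0]; have := valP u.
by rewrite -[val u]/(FinRing.uval u) -u0 unitr0.
Qed.

Lemma stable_units_image : stable_under (units_image A) (units_image A).
Proof.
move=> _ _ /imsetP[u uA ->] /imsetP[v vA ->].
by apply/imsetP; exists (u * v)%g; rewrite ?groupM.
Qed.
End UnitsImage.

Lemma powR_ratio_le_nat (R : realType) (q n a b : nat) : (0 < b)%N ->
  q%:R `^ (a%:R / b%:R) <= n%:R :> R -> (q ^ a <= n ^ b)%N.
Proof.
move=> b0 h; rewrite -(ler_nat R) !natrX.
have : (q%:R `^ (a%:R / b%:R)) ^+ b <= n%:R ^+ b :> R.
  by rewrite lerXn2r // ?nnegrE ?powR_ge0 ?ler0n.
by rewrite -powR_mulrn ?powR_ge0 // -powRrM mulfVK ?powR_mulrn ?ler0n // pnatr_eq0 -lt0n.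
Qed.

Theorem corollary8 (R : realType) (d : nat) (hd : (2 <= d)%N) :
  exists2 c : R, 0 < c &
    forall (q : nat) (A : {group {unit 'F_q}}),
      prime q -> odd q ->
      q%:R `^ ((9 * d + 36)%:R / (28 * d)%:R) <= #|A|%:R :> R ->
      c * q%:R <= #|distance_set (cart_power d (units_image A))|%:R.
Proof.
(* 2^(15d) bounds the powers of 2 lost in each of the three cases. *)
pose K := (2 ^ (15 * d) + 1)%N.
have K0 : (0 < K)%N by rewrite /K addn1.
exists K%:R^-1; first by rewrite invr_gt0 ltr0n.
move=> q A q_pr _ /powR_ratio_le_nat; rewrite muln_gt0 (ltnW hd) => /(_ isT) h.
rewrite -card_units_image in h.
(* A trivial group would contradict the size hypothesis, since q >= 2 and the exponent 9d + 36 is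
   positive. *)
have A_gt1 : (1 < #|units_image A|)%N.
  rewrite ltnNge; apply/negP => A_le1.
  have : (1 < 1)%N.
    apply: leq_trans (_ : q ^ (9 * d + 36) <= _)%N.
      apply: leq_trans (prime_gt1 q_pr) _; rewrite -{1}(expn1 q).
      by apply: leq_pexp2l; [exact: prime_gt0|lia].
    by apply: leq_trans h _; rewrite -[leqRHS](exp1n (28 * d)) leq_exp2r // muln_gt0 (ltnW hd).
  by [].
have := distances_ge q_pr (units_image1 A) (units_image0 A)
  (@stable_units_image _ A) A_gt1 hd h.
rewrite -/K => H; rewrite ler_pdivrMl ?ltr0n // -natrM ler_nat.
apply: leq_trans H _; rewrite leq_mul2l; apply/orP; right.
exact: subset_leq_card (iterated_sumset_distance_set _ _).
Qed.
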